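(* Let $\omega$ be a highest weight vector of $\mathcal T(z)$ with eigenvalues $(P_1(z),\dots,P_{\mathcal N}(z))$, i.e. $\omega\neq0$, $T_{ab}(z)\omega=0$ for $b<a$ and $T_{aa}(z)\omega=P_a(z)\omega$. Let $K(z)$ be the diagonal matrix with parameters $(\xi,\mathcal M)$ and let $\mathcal B(z)=\mathcal T(z)K(z)\mathcal T(z^{-1})^{-1}$. Then $\omega$ is also a highest weight vector for $\mathcal B(z)$, i.e. $B_{ij}(z)\omega=0$ for $j<i$, with eigenvalues $$B_{ii}(z)\,\omega=\Big(\Gamma_i(z)P_i(z)\widehat P_i(z^{-1})+\sum_{k=1}^{i-1}\frac{q^2-1}{q^{2k}z^4-1}\,\Gamma_k(z)P_k(z)\widehat P_k(z^{-1})\Big)\omega,$$ where $$\Gamma_k(z)=\frac{q^{k-1}\mathfrak b(z^2)}{\mathfrak b(q^{k-1}z^2)}\times\begin{cases}\alpha(z;\xi), & k\le\mathcal M,\\ q^{-2\mathcal M}\beta(zq^{\mathcal M};\xi), & k>\mathcal M,\end{cases}$$ and $$\widehat P_i(z)=\Big(\prod_{a=1}^{i-1}\frac{P_a(zq^{-a})}{P_a(zq^{-a+1})}\Big)\frac1{P_i(zq^{-i+1})}.$$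
   Context: $\mathcal N\ge2$, $q$ is a nonzero complex deformation parameter with $q^2\ne1$, $E_{ab}$ are elementary $\mathcal N\times\mathcal N$ matrices, $\mathfrak a(z)=qz-q^{-1}z^{-1}$, $\mathfrak b(z)=z-z^{-1}$, and $$R_{12}(z)=\mathfrak a(z)\sum_{a}E_{aa}\otimes E_{aa}+\mathfrak b(z)\sum_{a\ne b}E_{aa}\otimes E_{bb}+(q-q^{-1})\sum_{a\neq b}z^{\mathrm{sgn}(b-a)}E_{ab}\otimes E_{ba}.$$ $\mathcal T(z)=\sum_{a,b}E_{ab}\otimes T_{ab}(z)\in\mathrm{End}(\mathbb C^{\mathcal N})\otimes\mathrm{End}(V)$ is the monodromy matrix of $\mathcal U_q(\widehat{gl}(\mathcal N))$ (central charge $0$) in a finite-dimensional representation $V$ (for instance a tensor product of evaluation representations): its entries are rational in $z$, it is invertible for generic $z$, and it satisfies $R_{12}(\frac zw)\mathcal T_1(z)\mathcal T_2(w)=\mathcal T_2(w)\mathcal T_1(z)R_{12}(\frac zw)$. (In such representations the two generating matrices $\mathcal T^\pm(z)$ coincide up to a scalar function and are not distinguished.) Write $\mathcal B(z)=\sum_{a,b}E_{ab}\otimes B_{ab}(z)$. Diagonal $K$-matrix with parameters $(\xi,\mathcal M)$, $0\le\mathcal M\le\mathcal N$: $K(z)=\mathrm{diag}(\alpha,\dots,\alpha,\beta,\dots,\beta)$ with $\mathcal M$ entries $\alpha(z;\xi)=z^2(z^2-\xi^2)$ followed by $\mathcal N-\mathcal M$ entries $\beta(z;\xi)=1-\xi^2z^2$.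 All identities are identities of rational functions of $z$. *)

(* Defs.v *)
From HB Require Import structures.
From mathcomp Require Import all_boot all_order all_algebra.
From mathcomp Require Export reals.
From mathcomp Require Export complex mxtens.

Set Implicit Arguments.
Unset Strict Implicit.
Unset Printing Implicit Defensive.

Import GRing.Theory.
Local Open Scope ring_scope.
Local Open Scope quotient_scope.

Section Functions.
Context {L : fieldType}.
Implicit Types q z xi : L.

Definition fa q z : L := q * z - q^-1 * z^-1.
Definition fb z : L := z - z^-1.
Definition alpha xi z : L := z ^+ 2 * (z ^+ 2 - xi ^+ 2).
Definition beta xi z : L := 1 - xi ^+ 2 * z ^+ 2.

Definition Rmx (n : nat) q z : 'M[L]_(n * n) :=
  fa q z *: (\sum_(a < n) delta_mx a a *t delta_mx a a)
  + fb z *: (\sum_(a < n) \sum_(b < n | b != a) delta_mx a a *t delta_mx b b)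
  + (q - q^-1) *:
      (\sum_(a < n) \sum_(b < n | b != a)
         z ^ sgz (b%:Z - a%:Z) *: (delta_mx a b *t delta_mx b a)).

(* Row and column indices start at 0, so the first m diagonal entries are
   those of index a < m. *)
Definition Kmx (n m : nat) xi z : 'M[L]_n :=
  diag_mx (\row_(a < n) if (a < m)%N then alpha xi z else beta xi z).

(* Gamma_(k+1)(z): k is the 0-based index. *)
Definition Gamma (m : nat) q xi (k : nat) z : L :=
  q ^+ k * fb (z ^+ 2) / fb (q ^+ k * z ^+ 2)
  * (if (k < m)%N then alpha xi z else q ^- (2 * m) * beta xi (z * q ^+ m)).

(* blk X a b is the coefficient X_ab in X = sum_ab E_ab (x) X_ab. *)
Definition blk {n d : nat} (X : 'M[L]_(n * d)) (a b : 'I_n) : 'M[L]_d :=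
  \matrix_(k, l) X (mxtens_index (a, k)) (mxtens_index (b, l)).

(* X_1 and X_2, acting on (L^n (x) L^n) (x) L^d. *)
Definition leg1 {n d : nat} (X : 'M[L]_(n * d)) : 'M[L]_(n * n * d) :=
  \sum_(a < n) \sum_(b < n) (delta_mx a b *t 1%:M) *t blk X a b.
Definition leg2 {n d : nat} (X : 'M[L]_(n * d)) : 'M[L]_(n * n * d) :=
  \sum_(a < n) \sum_(b < n) (1%:M *t delta_mx a b) *t blk X a b.

Lemma blk_tensE (n d : nat) (X : 'M[L]_(n * d)) :
  X = \sum_(a < n) \sum_(b < n) delta_mx a b *t blk X a b.
Proof.
apply/matrixP => i j; case: (mxtens_indexP i) => a k.
case: (mxtens_indexP j) => b l; rewrite summxE (bigD1 a) //=.
rewrite [X in _ + X]big1 ?addr0 => [|a' ne].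
  rewrite summxE (bigD1 b) //= tensmxE !mxE !eqxx mul1r.
  rewrite big1 ?addr0 // => b' ne.
  by rewrite tensmxE !mxE eqxx eq_sym (negPf ne) mul0r.
rewrite summxE big1 // => b' _.
by rewrite tensmxE !mxE eq_sym (negPf ne) mul0r.
Qed.

End Functions.

Notation ratfun C := {fraction {poly C}}.

Section RationalFunctions.
Variable C : fieldType.

(* The value f(x) at a point x of an extension of C.  The fraction
   representing f need not be in lowest terms, so this is only meaningful at
   points x transcendental over C, such as z, 1/z and q^k / z in C(z). *)
Definition rat_eval (L : fieldType) (iota : {rmorphism C -> L})
    (f : ratfun C) (x : L) : L :=
  (map_poly iota \n_(repr f)).[x] / (map_poly iota \d_(repr f)).[x].

Definition cst : {rmorphism C -> ratfun C} :=
  (@tofrac {poly C} \o @polyC C : {rmorphism C -> ratfun C}).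
Definition zvar : ratfun C := tofrac 'X.

Lemma rat_eval_zvar (f : ratfun C) : rat_eval cst f zvar = f.
Proof.
have H (p : {poly C}) : (map_poly cst p).[zvar] = tofrac p.
  rewrite (map_poly_comp (@tofrac {poly C}) (@polyC C)) horner_map /=.
  by rewrite -[in RHS](comp_polyXr p).
rewrite /rat_eval !H -[RHS]reprK; set x := repr f.
have d0 : \d_x != 0 by exact: denom_ratioP.
apply: (mulIf (x := tofrac \d_x)); first by rewrite tofrac_eq0.
rewrite divfK ?tofrac_eq0 //; unlock FracField.tofrac.
rewrite -[RHS]FracField.pi_mul; apply/eqmodP.
rewrite /= /equivf /FracField.mulf !numden_Ratio ?mulf_neq0 ?oner_eq0 //.
by rewrite !(mulr1, mul1r) mulrC.
Qed.

(* The field C(z)(w), in which the two-variable identities are stated. *)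
Definition cst2 : {rmorphism C -> ratfun (ratfun C)} :=
  (@tofrac {poly ratfun C} \o @polyC (ratfun C) \o cst
     : {rmorphism C -> ratfun (ratfun C)}).
Definition zvar2 : ratfun (ratfun C) := tofrac zvar%:P.
Definition wvar2 : ratfun (ratfun C) := tofrac 'X.

Definition mx_eval (L : fieldType) (iota : {rmorphism C -> L}) (r s : nat)
    (X : 'M[ratfun C]_(r, s)) (x : L) : 'M[L]_(r, s) :=
  map_mx (fun f => rat_eval iota f x) X.

Section Monodromy.
Variables n d : nat.
Implicit Types (q xi : C) (T : 'M[ratfun C]_(n * d)).

Definition RTT q T : Prop :=
  let Rzw := Rmx n (cst2 q) (zvar2 / wvar2) *t 1%:M in
  let T1 := leg1 (mx_eval cst2 T zvar2) in
  let T2 := leg2 (mx_eval cst2 T wvar2) in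
  Rzw *m (T1 *m T2) = (T2 *m T1) *m Rzw.

Definition monodromy q T : Prop := T \in unitmx /\ RTT q T.

Definition highest_weight (X : 'M[ratfun C]_(n * d)) (omega : 'cV[C]_d)
    (P : 'I_n -> ratfun C) : Prop :=
  [/\ omega != 0,
      forall a b : 'I_n, (b < a)%N -> blk X a b *m map_mx cst omega = 0 &
      forall a : 'I_n, blk X a a *m map_mx cst omega = P a *: map_mx cst omega].

Definition Bmx m q xi T : 'M[ratfun C]_(n * d) :=
  T *m (Kmx n m (cst xi) zvar *t 1%:M) *m invmx (mx_eval cst T zvar^-1).

(* hat P_(i+1)(x), with the 1-based index a of the product shifted to a+1. *)
Definition Phat q (P : 'I_n -> ratfun C) (i : 'I_n) (x : ratfun C) : ratfun C :=
  (\prod_(a < n | (a < i)%N)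
     (rat_eval cst (P a) (x * cst q ^- a.+1)
      / rat_eval cst (P a) (x * cst q ^- a)))
  / rat_eval cst (P i) (x * cst q ^- i).

Definition Beigen m q xi (P : 'I_n -> ratfun C) (i : 'I_n) : ratfun C :=
  let term (k : 'I_n) := Gamma m (cst q) (cst xi) k zvar * P k * Phat q P k zvar^-1 in
  term i
  + \sum_(k < n | (k < i)%N)
      (cst q ^+ 2 - 1) / (cst q ^+ (2 * k.+1) * zvar ^+ 4 - 1) * term k.

End Monodromy.
End RationalFunctions.

(* Main.v *)
(* Let s = T(y)^-1.  If V_j is the space of vectors killed by all T_ab(x)
   with b <= j < a, the exchange relation makes the span of the
   e_b (x) v, b <= j, v in V_j, stable under T(x), hence under T(x)^-1 (a
   polynomial in T(x)).  So omega is a highest weight vector of s.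

   On omega, the exchange relation between T(x) and s turns into triangular
   linear systems, with u = x / y, for the vectors M_ik = T_ik(x) s_ki omega and
   L_ik = s_ik T_ki(x) omega.  Summing rows with the weights q^(2k) solves them.
   Writing m_i and l_i for the sums over k of M_ik and L_ik,
     (q^(2i) u^2 - 1) (m_i - m_(i-1)) = q^(2i) (u^2 - 1) (M_ii - L_(i-1)(i-1)),
     (q^(2i) u^2 - 1) (l_i - l_(i-1)) = (u^2 - 1) (L_ii - M_(i-1)(i-1)).
   At x = y q^-i the second identity gives L_ii = M_(i-1)(i-1), a recursion which
   computes the eigenvalues of s_ii (no quantum determinant is needed); at
   x = z, y = 1/z the first one gives the partial sums of the M_ik, and B_ii
   omega is a combination of two of these.

   All of this happens over the field C(z), at points transcendental over C. *)
From HB Require Import structures.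
Require Import Defs.
From mathcomp Require Import all_boot all_order all_algebra.
From mathcomp Require Import ring.
Set Implicit Arguments.
Unset Strict Implicit.
Unset Printing Implicit Defensive.
Import GRing.Theory Num.Theory.
Local Open Scope ring_scope.

(** * Exchange coefficients and the triangular linear systems they produce *)

Section Exchange.
Variable L : fieldType.
Implicit Types q u : L.

(* With the diagonal value a(u) - b(u), the exchange relations with equal and
   with distinct indices take one common form, [exchange] below. *)
Definition exch q u (a b : nat) : L :=
  if (a < b)%N then (q - q^-1) * u
  else if (b < a)%N then (q - q^-1) * u^-1 else fa q u - fb u.

(** The summands are (q - q^-1) u^-1 for k < d, a(u) for k = d and (q - q^-1) u for k > d. With the
    geometric weights their sum depends on d only through whether d < j. *)
Lemma exch_weight q u (d j : nat) : q != 0 ->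
  \sum_(k < j) q ^+ (2 * k) * (exch q u d k + fb u *+ (d == k)) =
    (q ^+ (2 * j) / q * fb u) *+ (d < j)%N
    + q^-1 * u^-1 * (q ^+ (2 * j) - 1).
Proof.
move=> q0; elim: j => [|j IH].
  by rewrite big_ord0 muln0 subrr mulr0 addr0.
rewrite big_ord_recr IH ltnS /=; case: (ltngtP d j) => [ltdj|ltjd|->].
- rewrite /exch ltdj addr0 !mulr1n mulnS exprD /fb.
  set X := q ^+ (2 * j); move: X (u^-1) => X v; by field.
- rewrite /exch (ltnNge d j) (ltnW ltjd) ltjd /= !addr0 !add0r.
  rewrite mulnS exprD.
  set X := q ^+ (2 * j); move: X (u^-1) => X v; by field.
- rewrite /exch !ltnn /= !mulr1n add0r subrK mulnS exprD /fa /fb.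
  set X := q ^+ (2 * j); move: X (u^-1) => X v; by field.
Qed.

(** This symmetry turns the system for the M_ik into the one for the L_ik. *)
Lemma exch_inv q u (a b : nat) : exch q^-1 u^-1 a b = - exch q u b a.
Proof. by rewrite /exch /fa /fb !invrK; case: ltngtP => _; ring. Qed.

Lemma fb_inv u : fb u^-1 = - fb u.
Proof. by rewrite /fb invrK opprB. Qed.

Lemma fb_neq0 u : u != 0 -> u ^+ 2 != 1 -> fb u != 0.
Proof.
move=> u0; apply: contra => /eqP fu0; apply/eqP.
by transitivity (u * fb u + 1); [rewrite /fb; field | rewrite fu0 mulr0 add0r].
Qed.

Section TriangularSystem.
Variables (e n : nat) (q u : L).
Local Notation V := 'cV[L]_e.
Hypotheses (q0 : q != 0) (u0 : u != 0).

(** Weighted and added, the first j equations retain only two unknowns: the partial sum below j and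
    the total sum. *)
Lemma exch_weight_sum (X : 'I_n -> V) (j : nat) : (j <= n)%N ->
  \sum_(k < n | (k < j)%N)
      q ^+ (2 * k) *: (\sum_(d < n) exch q u d k *: X d + fb u *: X k) =
  (q ^+ (2 * j) / q * fb u) *: \sum_(d < n | (d < j)%N) X d
  + (q^-1 * u^-1 * (q ^+ (2 * j) - 1)) *: \sum_d X d.
Proof.
move=> lejn; under eq_bigr => k _.
  rewrite (_ : fb u *: X k = \sum_(d < n) (fb u *+ (d == k :> nat)) *: X d); last first.
    rewrite (bigD1 k) //= eqxx big1 ?addr0 // => d /negPf nedk.
    by rewrite (inj_eq val_inj) nedk scale0r.
  rewrite -big_split /= scaler_sumr.
  under eq_bigr do rewrite -scalerDl scalerA.
  over.
rewrite exchange_big /=.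
under eq_bigr => d _ do rewrite -scaler_suml (big_ord_narrow lejn) /=
  exch_weight // scalerDl.
rewrite big_split /= -scaler_sumr; congr (_ + _).
rewrite scaler_sumr [RHS]big_mkcond; apply: eq_bigr => d _.
by case: ifP; rewrite ?scale0r.
Qed.

(* Applied to X = M with y = l, Y = diag L, and with q and u inverted to
   X = L with y = m, Y = diag M. *)
Variables (X : 'I_n -> 'I_n -> V) (y Y : 'I_n -> V).
Hypothesis Xtrig : forall i d : 'I_n, (i < d)%N -> X i d = 0.
Hypothesis Xsys : forall i k : 'I_n, (k <= i)%N ->
  \sum_(d < n) exch q u d k *: X i d + fb u *: X i k
  = ((q - q^-1) * u^-1) *: y k + ((q * fb u) *: Y i) *+ (k == i).
Let x i := \sum_d X i d.

(** The first j + 1 equations for i and for j have the same terms in y and differ on the right only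
    by [Y j] in the last one, so subtracting the weighted sums eliminates y. For j the partial sum
    is already the total [x j], by triangularity. *)
Lemma triangular_partial_sum (i j : 'I_n) : (j < i)%N ->
  (q ^+ (2 * j.+1) * (u ^+ 2 - 1)) *:
     (\sum_(d < n | (d <= j)%N) X i d - x j + Y j)
  = (q ^+ (2 * j.+1) - 1) *: (x j - x i).
Proof.
move=> ltji; have := exch_weight_sum (X i) (ltn_ord j).
have := exch_weight_sum (X j) (ltn_ord j).
rewrite (eq_bigl (fun k : 'I_n => (k <= j)%N)) //.
under eq_bigr => k lekj do rewrite Xsys // scalerDr.
rewrite big_split /=.
under [X in _ + X]eq_bigr => k lekj do rewrite mulrb fun_if scaler0.
rewrite -big_mkcondr /= [X in _ + X = _](big_pred1 j) => [|k]; last first.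
  by rewrite /=; case: eqP => [->|]; rewrite ?leqnn ?andbF.
move=> Ej.
rewrite (eq_bigl (fun k : 'I_n => (k <= j)%N)) //.
under eq_bigr => k lekj.
  rewrite Xsys ?(leq_trans lekj (ltnW ltji)) //.
  rewrite -(inj_eq val_inj) (ltn_eqF (leq_ltn_trans lekj ltji)) addr0.
  over.
move=> Ei; move: Ej; rewrite Ei => {Ei}.
rewrite (eq_bigl (fun k : 'I_n => (k <= j)%N)) //.
rewrite [X in _ = _ *: X + _](_ : _ = x j); last first.
  rewrite /x [RHS](bigID (fun d : 'I_n => (d <= j)%N)) /=.
  by rewrite [X in _ + X]big1 ?addr0 // => d; rewrite -ltnNge => /Xtrig.
rewrite -/(x i) -/(x j); set s := \sum_(d < n | _) _.
rewrite scalerA mulnS exprD; set Q := q ^+ (2 * j).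
move: s (x i) (x j) (Y j) Q => s xi xj Yj Q E.
apply/matrixP => r c; move/matrixP/(_ r c): E; rewrite !mxE /fb.
move: (s r c) (xi r c) (xj r c) (Yj r c) => {}s {}xi {}xj {}Yj E.
apply: (mulfI (x := q^-1 * u^-1)); first by rewrite mulf_neq0 ?invr_eq0.
apply/eqP; rewrite -subr_eq0; move/eqP: E; rewrite -subr_eq0 => /eqP <-.
by apply/eqP; field; rewrite u0.
Qed.

(** When j = i - 1 the partial sum misses only the diagonal term of row i. *)
Lemma triangular_step (i j : 'I_n) : i = j.+1 :> nat ->
  (q ^+ (2 * i) * u ^+ 2 - 1) *: (x i - x j)
  = (q ^+ (2 * i) * (u ^+ 2 - 1)) *: (X i i - Y j).
Proof.
move=> ij; have := @triangular_partial_sum i j; rewrite ij ltnSn => /(_ isT).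
have -> : \sum_(d < n | (d <= j)%N) X i d = x i - X i i.
  rewrite /x [in RHS](bigD1 i) //= [X i i + _]addrC addrK [RHS]big_mkcond /=.
  rewrite big_mkcond; apply: eq_bigr => d _; rewrite -(inj_eq val_inj) /= ij -ltnS.
  by case: ltngtP => // lt; rewrite Xtrig // ij.
set Q := q ^+ _; move: Q (x i) (x j) (X i i) (Y j) => Q xi xj Xi Yj E.
apply/matrixP => r c; move/matrixP/(_ r c): E; rewrite !mxE.
move: (Xi r c) (xi r c) (xj r c) (Yj r c) => {}Xi {}xi {}xj {}Yj E.
apply/eqP; rewrite -subr_eq0; move/eqP: E; rewrite -subr_eq0 => /eqP <-.
by apply/eqP; ring.
Qed.

(** If u = u^-1 then b(u) = 0 and a(u) = (q - q^-1) u, so all coefficients on both sides equal (q -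
    q^-1) u, which is nonzero and cancels. *)
Lemma triangular_degenerate (i k : 'I_n) : q ^+ 2 != 1 -> u ^+ 2 = 1 ->
  (k <= i)%N -> x i = y k.
Proof.
move=> q21 u21 leki; have uV : u^-1 = u.
  by apply: (mulfI u0); rewrite mulfV // -expr2.
have := Xsys leki; rewrite /fb uV subrr mulr0 !scale0r mul0rn !addr0.
under eq_bigr => d _.
  rewrite (_ : exch q u d k = (q - q^-1) * u); last first.
    by rewrite /exch /fa /fb uV; case: ifP => // _; case: ifP => // _; ring.
  over.
rewrite -scaler_sumr => /scalerI; apply; rewrite mulf_neq0 // subr_eq0.
by apply: contra q21 => /eqP qV; rewrite expr2 {1}qV mulVf.
Qed.

End TriangularSystem.
End Exchange.

(** * Blocks of matrices on a tensor product, and the exchange relation with an inverse *)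

Section Blocks.
Variables (L : fieldType) (n d : nat).
Implicit Types X Y : 'M[L]_(n * d).

Lemma sum_mxtens (V : nmodType) (F : 'I_(n * d) -> V) :
  \sum_i F i = \sum_a \sum_k F (mxtens_index (a, k)).
Proof.
rewrite pair_big (reindex (@mxtens_index n d)) //=.
  by apply: eq_bigr => -[].
exists (@mxtens_unindex n d) => i _; first exact: mxtens_indexK.
exact: mxtens_unindexK.
Qed.

Lemma blkM X Y a c : blk (X *m Y) a c = \sum_b blk X a b *m blk Y b c.
Proof.
apply/matrixP => k l; rewrite !mxE sum_mxtens summxE.
by apply: eq_bigr => b _; rewrite mxE; apply: eq_bigr => j _; rewrite !mxE.
Qed.

Lemma blk1 a b : blk (1%:M : 'M[L]_(n * d)) a b = (a == b)%:R%:M.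
Proof.
apply/matrixP => k l; rewrite !mxE (can_eq (@mxtens_indexK _ _)) xpair_eqE.
by case: eqP; case: eqP => //=; rewrite mul0rn.
Qed.

Lemma blkD X Y a b : blk (X + Y) a b = blk X a b + blk Y a b.
Proof. by apply/matrixP => k l; rewrite !mxE. Qed.

Lemma blkZ (x : L) X a b : blk (x *: X) a b = x *: blk X a b.
Proof. by apply/matrixP => k l; rewrite !mxE. Qed.

Lemma sum_scalar_mx (I : finType) (m e : nat) (F : I -> 'M[L]_(m, e)) (i : I) :
  \sum_j F j *m (j == i)%:R%:M = F i.
Proof.
rewrite (bigD1 i) //= eqxx mulmx1 big1 ?addr0 // => j /negPf ->.
by rewrite mulr0n raddf0 mulmx0.
Qed.

Lemma blk_mulV X : X \in unitmx ->
  forall a c, \sum_b blk X a b *m blk (invmx X) b c = (a == c)%:R%:M.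
Proof. by move=> uX a c; rewrite -blkM mulmxV // blk1. Qed.

Lemma blk_mulVl X : X \in unitmx ->
  forall a c, \sum_b blk (invmx X) a b *m blk X b c = (a == c)%:R%:M.
Proof. by move=> uX a c; rewrite -blkM mulVmx // blk1. Qed.

(* The entries of R(u) A_1 B_2 = B_2 A_1 R(u). *)
Definition exchange q u (A B : 'M[L]_(n * d)) : Prop :=
  forall a b c e : 'I_n,
    fb u *: (blk A a c *m blk B b e - blk B b e *m blk A a c)
    = exch q u e c *: (blk B b c *m blk A a e)
      - exch q u a b *: (blk A b c *m blk B a e).

(** The exchange relation is multiplied by B^-1 on both sides, in the second leg only; the products
    B^-1 B and B B^-1 then contract to Kronecker deltas. *)
Lemma exchange_inv q u A B : B \in unitmx -> exchange q u A B ->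
  forall a c e f : 'I_n,
    let B' := invmx B in
    fb u *: (blk B' e f *m blk A a c - blk A a c *m blk B' e f)
    = (\sum_(g < n) exch q u g c *: (blk A a g *m blk B' g f)) *+ (e == c)
      - (\sum_(b < n) exch q u a b *: (blk B' e b *m blk A b c)) *+ (a == f).
Proof.
move=> uB AB a c e f B'.
have BV x y := blk_mulV uB x y; have VB x y := blk_mulVl uB x y.
have: \sum_(b < n) \sum_(g < n) blk B' e b *m (fb u *: (blk A a c *m blk B b g
        - blk B b g *m blk A a c)) *m blk B' g f
    = \sum_(b < n) \sum_(g < n) blk B' e b *m (exch q u g c *: (blk B b c *m blk A a g)
        - exch q u a b *: (blk A b c *m blk B a g)) *m blk B' g f.
  by apply: eq_bigr => b _; apply: eq_bigr => g _; rewrite AB.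
under eq_bigr => b _.
  under eq_bigr => g _ do
    rewrite -scalemxAr -scalemxAl mulmxBr mulmxBl.
  rewrite -scaler_sumr sumrB.
  under eq_bigr => g _ do rewrite -!mulmxA.
  rewrite -!mulmx_sumr BV.
  over.
rewrite -scaler_sumr sumrB.
under [in LHS]eq_bigr => b _ do rewrite mulmxA.
rewrite sum_scalar_mx.
have -> : \sum_(b < n) \sum_(g < n) blk B' e b *m (blk B b g *m blk A a c) *m blk B' g f
   = blk A a c *m blk B' e f.
  rewrite exchange_big /=.
  under eq_bigr => g _.
    under eq_bigr => b _ do rewrite mulmxA.
    rewrite -!mulmx_suml VB -mulmxA.
    over.
  rewrite (bigD1 e) //= eqxx mul1mx big1 ?addr0 // => g; rewrite eq_sym.
  by move=> /negPf ->; rewrite mulr0n raddf0 mul0mx.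
move=> ->.
under eq_bigr => b _.
  under eq_bigr => g _ do
    rewrite mulmxBr mulmxBl -!(scalemxAr, scalemxAl).
  rewrite sumrB.
  over.
rewrite sumrB; congr (_ - _).
  rewrite exchange_big /=.
  under eq_bigr => g _.
    rewrite -scaler_sumr.
    under eq_bigr => b _ do rewrite !mulmxA.
    rewrite -!mulmx_suml VB.
    over.
  case: eqP => _; last first.
    by rewrite big1 // => g _; rewrite mulr0n raddf0 !mul0mx scaler0.
  by apply: eq_bigr => g _; rewrite mul1mx.
under eq_bigr => b _.
  rewrite -scaler_sumr.
  under eq_bigr => g _ do rewrite -!mulmxA.
  rewrite -!mulmx_sumr BV.
  over.
case: eqP => _; last first.
  by rewrite big1 // => g _; rewrite mulr0n raddf0 !mulmx0 scaler0.
by apply: eq_bigr => g _; rewrite mulmx1.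
Qed.

End Blocks.

(* By Cayley-Hamilton, the inverse of A is a polynomial in A. *)
Lemma invmx_closed (L : fieldType) (N : nat) (Q : 'M[L]_N -> Prop) (A : 'M_N) :
  Q 0 -> Q 1%:M -> (forall X Y, Q X -> Q Y -> Q (X + Y)) ->
  (forall x X, Q X -> Q (x *: X)) -> (forall X Y, Q X -> Q Y -> Q (X *m Y)) ->
  A \in unitmx -> Q A -> Q (invmx A).
Proof.
case: N Q A => [|N] Q A Q0 Q1 QD QZ QM uA QA.
  by rewrite (flatmx0 (invmx A)) -(flatmx0 0).
have Qhorner p : Q (horner_mx A p).
  elim/poly_ind: p => [|p c IH]; first by rewrite rmorph0.
  rewrite rmorphD rmorphM /= horner_mx_X horner_mx_C.
  by apply: QD; [apply: QM | rewrite -scalemx1; apply: QZ].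
(* Up to sign p_0 is det A. With p = r X + p_0, Cayley-Hamilton gives A^-1 = - r(A) / p_0. *)
pose p : {poly L} := char_poly A; have p0 : p`_0 != 0.
  by rewrite char_poly_det mulf_neq0 ?signr_eq0 // -unitfE -unitmxE.
have [r pE] : exists r, p = r * 'X + (p`_0)%:P.
  exists (\poly_(i < size p) p`_i.+1); apply/polyP => -[|i].
    by rewrite coefD coefMX coefC add0r.
  rewrite coefD coefMX coefC /= addr0 coef_poly; case: ltnP => // le_p_i.
  by rewrite nth_default // (leq_trans le_p_i).
have := Cayley_Hamilton A; rewrite -/p pE rmorphD rmorphM /=.
rewrite horner_mx_X horner_mx_C => /eqP; rewrite addr_eq0 => /eqP rA.
have -> : invmx A = (- p`_0)^-1 *: horner_mx A r.
  apply: (canRL (scalerK _)); first by rewrite oppr_eq0.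
  by rewrite -[RHS](mulmxK uA) [horner_mx A r *m A]rA -raddfN mul_scalar_mx.
exact: QZ.
Qed.

(** * Highest weight vectors over an abstract set S of admissible points *)

Section HighestWeight.
Variables (L : fieldType) (n d : nat) (q : L) (S : L -> Prop).
Variables (T : L -> 'M[L]_(n * d)) (omega : 'cV[L]_d) (P : 'I_n -> L -> L).
Hypotheses (q0 : q != 0) (q21 : q ^+ 2 != 1).
Hypothesis S_neq0 : forall x, S x -> x != 0.
Hypothesis S_mulX : forall x k, S x -> S (x * q ^+ k).
Hypothesis S_mulNX : forall x k, S x -> S (x * q ^- k).
Hypothesis T_unit : forall x, S x -> T x \in unitmx.
Hypothesis T_exchange : forall x y, S x -> S y -> exchange q (x / y) (T x) (T y).
(* The entries of T are rational functions: a linear relation between them which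
   holds outside a finite set holds everywhere. *)
Hypothesis T_dense : forall f : 'M[L]_(n * d) -> 'cV[L]_d, linear f ->
  forall E : seq L, (forall x, S x -> x \notin E -> f (T x) = 0) ->
  forall x, S x -> f (T x) = 0.
Hypothesis omega_neq0 : omega != 0.
Hypothesis T_low : forall x (a b : 'I_n), S x -> (b < a)%N ->
  blk (T x) a b *m omega = 0.
Hypothesis T_diag : forall x (a : 'I_n), S x ->
  blk (T x) a a *m omega = P a x *: omega.

Lemma ratio_neq0 x y : S x -> S y -> x / y != 0.
Proof. by move=> Sx Sy; rewrite mulf_neq0 ?invr_eq0 ?S_neq0. Qed.

Lemma ratio_sqr_neq1 x y : S y -> x \notin [:: y; - y] -> (x / y) ^+ 2 != 1.
Proof.
move=> Sy; rewrite !inE; apply: contra; rewrite sqrf_eq1 => /orP[] /eqP xy.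
  by rewrite -[x](divfK (S_neq0 Sy)) xy mul1r eqxx.
by rewrite -[x](divfK (S_neq0 Sy)) xy mulN1r eqxx orbT.
Qed.

(** * The invariant subspaces that make omega a highest weight vector of T(x)^-1 *)

Section Annihilator.
Variable j : 'I_n.

Definition annih (v : 'cV[L]_d) := forall y (a b : 'I_n), S y ->
  (b <= j)%N -> (j < a)%N -> blk (T y) a b *m v = 0.

(** Stability under X of the span of the e_b (x) v, b <= j, v in V_j, read block by block; V_j is
    the space described by [annih]. *)
Definition stabilizes (X : 'M[L]_(n * d)) :=
  forall (b : 'I_n) v, (b <= j)%N -> annih v ->
    (forall a : 'I_n, (a <= j)%N -> annih (blk X a b *m v))
    /\ (forall a : 'I_n, (j < a)%N -> blk X a b *m v = 0).

Lemma annih0 : annih 0.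
Proof. by move=> *; rewrite mulmx0. Qed.

Lemma annihD v w : annih v -> annih w -> annih (v + w).
Proof. by move=> av aw y a b Sy lb la; rewrite mulmxDr av ?aw ?addr0. Qed.

Lemma annihZ c v : annih v -> annih (c *: v).
Proof. by move=> av y a b Sy lb la; rewrite -scalemxAr av ?scaler0. Qed.

Lemma annih_sum (I : Type) (r : seq I) (K : pred I) F :
  (forall i, K i -> annih (F i)) -> annih (\sum_(i <- r | K i) F i).
Proof. by move=> aF; apply: big_ind => //; [exact: annih0 | exact: annihD]. Qed.

Lemma stabilizesM X Y : stabilizes X -> stabilizes Y -> stabilizes (X *m Y).
Proof.
move=> sX sY b v lb av; have [aY Y0] := sY b v lb av.
split=> a la; rewrite blkM mulmx_suml.
  apply: annih_sum => c _; rewrite -mulmxA; case: (leqP c j) => lc.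
    by have [aX _] := sX c _ lc (aY c lc); exact: aX.
  by rewrite Y0 // mulmx0; exact: annih0.
rewrite big1 // => c _; rewrite -mulmxA; case: (leqP c j) => lc.
  by have [_ ->] := sX c _ lc (aY c lc).
by rewrite Y0 // mulmx0.
Qed.

(** In the exchange relation for T_ce(y) T_ab(x) with a, b, e <= j < c, every other term has on its
    right an operator that kills v. The factor b(y / x) vanishes only at y = x and y = -x, which are
    reached by density. *)
Lemma stabilizesT x : S x -> stabilizes (T x).
Proof.
move=> Sx b v lb av; split=> a la; last exact: av.
move=> y c e Sy le lc.
pose f (Z : 'M[L]_(n * d)) := blk Z c e *m (blk (T x) a b *m v).
have lin_f : linear f.
  by move=> t X Y; rewrite /f blkD blkZ mulmxDl scalemxAl.
apply: (T_dense lin_f (E := [:: x; - x])) Sy => {}y Sy /(ratio_sqr_neq1 Sx) uy.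
have := congr1 (fun Z => Z *m v) (T_exchange Sy Sx c a e b).
rewrite -scalemxAl !mulmxBl -!scalemxAl -!mulmxA (av y c b) // (av x c b) //.
rewrite (av y c e) // !(mulmx0, scaler0, subr0) => /eqP.
rewrite scaler_eq0 (negPf (fb_neq0 _ uy)) ?ratio_neq0 //=.
by move/eqP.
Qed.

Lemma stabilizes_inv x : S x -> stabilizes (invmx (T x)).
Proof.
move=> Sx; apply: invmx_closed (T_unit Sx) (stabilizesT Sx).
- move=> b v lb av; split=> a la.
    by rewrite (_ : blk _ _ _ = 0) ?mul0mx; [exact: annih0 |
      apply/matrixP => k l; rewrite !mxE].
  by rewrite (_ : blk _ _ _ = 0) ?mul0mx //; apply/matrixP => k l; rewrite !mxE.
- move=> b v lb av; split=> a la; rewrite blk1 mul_scalar_mx.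
    exact: annihZ.
  by rewrite -(inj_eq val_inj) (gtn_eqF (leq_ltn_trans lb la)) scale0r.
- move=> X Y sX sY b v lb av; have [aX X0] := sX b v lb av.
  have [aY Y0] := sY b v lb av; split=> a la; rewrite blkD mulmxDl.
    by apply: annihD; auto.
  by rewrite X0 ?Y0 ?addr0.
- move=> c X sX b v lb av; have [aX X0] := sX b v lb av.
  split=> a la; rewrite blkZ -scalemxAl; first by apply: annihZ; auto.
  by rewrite X0 ?scaler0.
- exact: stabilizesM.
Qed.

(** [omega] lies in every V_j, so e_j (x) omega lies in the stable span, whose vectors have no
    component beyond j. *)
Lemma invT_low x (a : 'I_n) : S x -> (j < a)%N ->
  blk (invmx (T x)) a j *m omega = 0.
Proof.
move=> Sx lja; have [_] := stabilizes_inv Sx (leqnn j)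
  (fun y a b Sy lb la => T_low Sy (leq_ltn_trans lb la)).
exact.
Qed.

End Annihilator.

(** * The linear systems linking T(x) and T(y)^-1 on omega *)

Section TwoPoints.
Variables x y : L.
Hypotheses (Sx : S x) (Sy : S y).
Let u := x / y.
Let u0 : u != 0. Proof. exact: ratio_neq0. Qed.

(** [TinvT] and [invTT] are the vectors M_ik and L_ik. *)
Definition TinvT (i k : 'I_n) : 'cV[L]_d :=
  blk (T x) i k *m (blk (invmx (T y)) k i *m omega).
Definition invTT (i k : 'I_n) : 'cV[L]_d :=
  blk (invmx (T y)) i k *m (blk (T x) k i *m omega).

Lemma TinvT_trig (i k : 'I_n) : (i < k)%N -> TinvT i k = 0.
Proof. by move=> ltik; rewrite /TinvT invT_low ?mulmx0. Qed.

Lemma invTT_trig (i k : 'I_n) : (i < k)%N -> invTT i k = 0.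
Proof. by move=> ltik; rewrite /invTT T_low ?mulmx0. Qed.

Lemma TinvT_exchange (i k : 'I_n) :
  fb u *: (invTT k i - TinvT i k)
  = \sum_(g < n) exch q u g k *: TinvT i g - \sum_(b < n) exch q u i b *: invTT k b.
Proof.
have := exchange_inv (T_unit Sy) (T_exchange Sx Sy) i k k i.
rewrite !eqxx => /(congr1 (fun Z => Z *m omega)).
rewrite -scalemxAl !mulmxBl -!mulmxA => ->; rewrite !mulmx_suml.
by congr (_ - _); apply: eq_bigr => g _; rewrite -scalemxAl -mulmxA.
Qed.

(** Triangularity leaves only b <= k <= i, where the coefficient is constant except at b = k = i;
    there a(u) - b(u) exceeds (q - q^-1) u^-1 by (q - 1) b(u). *)
Lemma exch_sum_invTT (i k : 'I_n) : (k <= i)%N ->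
  \sum_(b < n) exch q u i b *: invTT k b
  = ((q - q^-1) * u^-1) *: \sum_b invTT k b
    + ((q * fb u - fb u) *: invTT i i) *+ (k == i).
Proof.
rewrite leq_eqVlt => /orP[/eqP /val_inj -> | ltki]; last first.
  rewrite -(inj_eq val_inj) (ltn_eqF ltki) addr0 scaler_sumr.
  apply: eq_bigr => b _; case: (leqP b k) => [lebk | /invTT_trig ->].
    by rewrite /exch ltnNge (ltnW (leq_ltn_trans lebk ltki)) /= (leq_ltn_trans lebk).
  by rewrite !scaler0.
rewrite eqxx (bigD1 i) //= [in RHS](bigD1 i) //= scalerDr addrAC.
rewrite -scalerDl; congr (_ *: _ + _).
  by rewrite /exch ltnn /fa /fb; ring.
rewrite scaler_sumr; apply: eq_bigr => b; rewrite -(inj_eq val_inj) /exch.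
by case: ltngtP => // /invTT_trig ->; rewrite !scaler0.
Qed.

Lemma exch_sum_TinvT (i k : 'I_n) : (k <= i)%N ->
  \sum_(b < n) exch q u b i *: TinvT k b
  = ((q - q^-1) * u) *: \sum_b TinvT k b
    + ((q^-1 * fb u - fb u) *: TinvT i i) *+ (k == i).
Proof.
rewrite leq_eqVlt => /orP[/eqP /val_inj -> | ltki]; last first.
  rewrite -(inj_eq val_inj) (ltn_eqF ltki) addr0 scaler_sumr.
  apply: eq_bigr => b _; case: (leqP b k) => [lebk | /TinvT_trig ->].
    by rewrite /exch (leq_ltn_trans lebk).
  by rewrite !scaler0.
rewrite eqxx (bigD1 i) //= [in RHS](bigD1 i) //= scalerDr addrAC.
rewrite -scalerDl; congr (_ *: _ + _).
  by rewrite /exch ltnn /fa /fb; ring.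
rewrite scaler_sumr; apply: eq_bigr => b; rewrite -(inj_eq val_inj) /exch.
by case: ltngtP => // /TinvT_trig ->; rewrite !scaler0.
Qed.

Lemma TinvT_system (i k : 'I_n) : (k <= i)%N ->
  \sum_(g < n) exch q u g k *: TinvT i g + fb u *: TinvT i k
  = ((q - q^-1) * u^-1) *: \sum_b invTT k b
    + ((q * fb u) *: invTT i i) *+ (k == i).
Proof.
move=> leki; have /eqP := TinvT_exchange i k.
rewrite eq_sym subr_eq exch_sum_invTT // => /eqP ->.
rewrite scalerBr addrAC subrK addrCA; congr (_ + _).
case: eqP => [->|/eqP neki]; first by rewrite !mulr1n -scalerDl addrC subrK.
rewrite !mulr0n addr0 invTT_trig ?scaler0 //.
by rewrite ltn_neqAle leki -(inj_eq val_inj) in neki *; rewrite neki.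
Qed.

(** [TinvT_exchange] with i and k swapped; by [exch_inv] it takes the shape of [TinvT_system] with q
    and u inverted and the roles of M and L exchanged. *)
Lemma invTT_system (i k : 'I_n) : (k <= i)%N ->
  \sum_(g < n) exch q^-1 u^-1 g k *: invTT i g + fb u^-1 *: invTT i k
  = ((q^-1 - q^-1^-1) * u^-1^-1) *: \sum_b TinvT k b
    + ((q^-1 * fb u^-1) *: TinvT i i) *+ (k == i).
Proof.
move=> leki; under eq_bigr do rewrite exch_inv scaleNr.
rewrite sumrN fb_inv scaleNr -opprD !invrK.
have := TinvT_exchange k i; rewrite exch_sum_TinvT // => E.
apply/eqP; rewrite eqr_oppLR; apply/eqP.
transitivity (fb u *: (invTT i k - TinvT k i) + fb u *: TinvT k i
   + \sum_(b < n) exch q u k b *: invTT i b).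
  by rewrite -scalerDr subrK addrC.
rewrite E addrAC subrK.
have -> : fb u *: TinvT k i = (fb u *: TinvT i i) *+ (k == i).
  case: eqP => [->//|/eqP neki]; rewrite TinvT_trig ?scaler0 //.
  by rewrite ltn_neqAle leki -(inj_eq val_inj) in neki *; rewrite neki.
move: (\sum_b _) => m; apply/matrixP => r c.
by case: (k == i); rewrite !mxE; ring.
Qed.

Lemma TinvT_step (i j : 'I_n) : i = j.+1 :> nat ->
  (q ^+ (2 * i) * u ^+ 2 - 1) *: (\sum_b TinvT i b - \sum_b TinvT j b)
  = (q ^+ (2 * i) * (u ^+ 2 - 1)) *: (TinvT i i - invTT j j).
Proof. by move=> ij; exact: (triangular_step q0 u0 TinvT_trig TinvT_system ij). Qed.

Lemma invTT_step (i j : 'I_n) : i = j.+1 :> nat ->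
  (q ^+ (2 * i) * u ^+ 2 - 1) *: (\sum_b invTT i b - \sum_b invTT j b)
  = (u ^+ 2 - 1) *: (invTT i i - TinvT j j).
Proof.
move=> ij; have qV0 : q^-1 != 0 by rewrite invr_eq0.
have uV0 : u^-1 != 0 by rewrite invr_eq0.
have E := triangular_step qV0 uV0 invTT_trig invTT_system ij.
have Q0 : q ^+ (2 * i) != 0 by rewrite expf_neq0.
move: E; rewrite exprVn /=; move: (q ^+ _) Q0 => Q Q0.
move: (\sum_b invTT i b) (\sum_b invTT j b) (invTT i i) (TinvT j j).
move=> s t v w E; apply/matrixP => r c; move/matrixP/(_ r c): E; rewrite !mxE.
move: (s r c) (t r c) (v r c) (w r c) => {}s {}t {}v {}w E.
transitivity (- (Q * u ^+ 2) * ((Q^-1 * u^-1 ^+ 2 - 1) * (s - t))).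
  by field; rewrite u0.
by rewrite E; field; rewrite u0.
Qed.

Lemma invTT_degenerate (i j : 'I_n) : u ^+ 2 = 1 -> i = j.+1 :> nat ->
  \sum_b invTT i b = \sum_b invTT j b.
Proof.
move=> u21 ij; have qV0 : q^-1 != 0 by rewrite invr_eq0.
have uV0 : u^-1 != 0 by rewrite invr_eq0.
have qV21 : q^-1 ^+ 2 != 1 by rewrite exprVn invr_eq1.
have uV21 : u^-1 ^+ 2 = 1 by rewrite exprVn u21 invr1.
have ltji : (j <= i)%N by rewrite ij.
have deg a b := @triangular_degenerate _ _ _ _ _ qV0 uV0 _ _ _ invTT_system a b qV21 uV21.
(* Both sums equal the sum of the [TinvT j b]. *)
by rewrite (deg i j) // (deg j j).
Qed.

Lemma TinvT_partial_sum (i j : 'I_n) : (j < i)%N ->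
  (q ^+ (2 * j.+1) * (u ^+ 2 - 1)) *:
     (\sum_(k < n | (k <= j)%N) TinvT i k - \sum_k TinvT j k + invTT j j)
  = (q ^+ (2 * j.+1) - 1) *: (\sum_k TinvT j k - \sum_k TinvT i k).
Proof. exact: (triangular_partial_sum q0 u0 TinvT_trig TinvT_system). Qed.

End TwoPoints.

(* If q^(2i) = 1, the point x = y q^-i satisfies u^2 = 1, where [invTT_step] is
   void; there the identity is reached by density from the points u^2 <> 1. *)
Lemma invTT_fusion y (i j : 'I_n) : S y -> i = j.+1 :> nat ->
  let x := y * q ^- i in invTT x y i i = TinvT x y j j.
Proof.
move=> Sy ij x; have Sx : S x by exact: S_mulNX.
have xy2 : q ^+ (2 * i) * (x / y) ^+ 2 = 1.
  rewrite /x mulrAC mulfV ?S_neq0 // mul1r -exprVn -exprM mulnC -exprMn.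
  by rewrite mulfV // expr1n.
have [q1|q1] := eqVneq (q ^+ (2 * i)) 1; last first.
  have := invTT_step Sx Sy ij; rewrite xy2 subrr scale0r => /esym /eqP.
  rewrite scaler_eq0 !subr_eq0 => /orP[|/eqP //] /eqP xy1.
  by rewrite xy1 mulr1 in xy2; rewrite xy2 eqxx in q1.
(* With T(y) fixed, f is (l_i - l_j) - (L_ii - M_jj) as a linear function of T(x). Since q^(2i) = 1,
   both scalars in [invTT_step] are u^2 - 1, so f vanishes off y and -y. *)
pose f (Z : 'M[L]_(n * d)) :=
  (\sum_b blk (invmx (T y)) i b *m (blk Z b i *m omega)
   - \sum_b blk (invmx (T y)) j b *m (blk Z b j *m omega))
  - (blk (invmx (T y)) i i *m (blk Z i i *m omega)
     - blk Z j j *m (blk (invmx (T y)) j j *m omega)).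
have lin_f : linear f.
  pose g (a b : 'I_n) (v : 'cV[L]_d) (Z : 'M[L]_(n * d)) :=
    blk (invmx (T y)) a b *m (blk Z b a *m v).
  have lin_g a b v t X Y : g a b v (t *: X + Y) = t *: g a b v X + g a b v Y.
    by rewrite /g blkD blkZ mulmxDl mulmxDr -scalemxAl -scalemxAr.
  have lin_s a t X Y : \sum_b g a b omega (t *: X + Y)
      = t *: \sum_b g a b omega X + \sum_b g a b omega Y.
    by rewrite scaler_sumr -big_split; apply: eq_bigr.
  move=> t X Y; rewrite /f; move: (lin_s i t X Y) (lin_s j t X Y) => /= -> ->.
  rewrite -[blk (invmx _) i i *m _]/(g i i omega (t *: X + Y)) lin_g.
  rewrite [blk (_ + _) j j]blkD blkZ mulmxDl -scalemxAl /g.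
  move: (\sum_b _) (\sum_b _) (\sum_b _) (\sum_b _) => s1 s2 s3 s4.
  move: (_ *m _) (_ *m _) (_ *m _) (_ *m _) => g1 g2 h1 h2.
  by apply/matrixP => r c; rewrite !mxE; ring.
have : f (T x) = 0.
  apply: (T_dense lin_f (E := [:: y; - y])) Sx => z Sz /(ratio_sqr_neq1 Sy) zy.
  have := invTT_step Sz Sy ij; rewrite q1 mul1r => /scalerI.
  by rewrite subr_eq0 => /(_ zy) E; apply/eqP; rewrite subr_eq0; apply/eqP.
(* At the point x itself u^2 = 1 and l_i = l_j, so what is left of f is the claim. *)
rewrite /f (invTT_degenerate Sx Sy _ ij) ?subrr ?sub0r; last first.
  by rewrite -[LHS]mul1r -[X in X * _]q1.
by move=> /eqP; rewrite oppr_eq0 subr_eq0 => /eqP.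
Qed.

(** The value at y of hat P_(i+1), for weights given as functions of the point. *)
Definition invT_eigen (i : 'I_n) y : L :=
  (\prod_(a < n | (a < i)%N) (P a (y * q ^- a.+1) / P a (y * q ^- a)))
  / P i (y * q ^- i).

(** Strong induction, carrying the nonvanishing of the weights along with the eigenvalue. Index 0
    comes from T(y)^-1 T(y) = 1, where only T_00 contributes on omega; each further index comes from
    [invTT_fusion]. *)
Lemma invT_diag (i : 'I_n) y : S y ->
  P i y != 0 /\ blk (invmx (T y)) i i *m omega = invT_eigen i y *: omega.
Proof.
case: i => i lti; elim/ltn_ind: i lti y => -[|k] IH lti y Sy.
  set I := Ordinal lti.
  have := congr1 (fun Z => blk Z I I *m omega) (mulVmx (T_unit Sy)).
  rewrite blkM blk1 eqxx mul1mx mulmx_suml (bigD1 I) //= big1 => [|b neb].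
    rewrite addr0 -mulmxA T_diag // -scalemxAr => PI.
    have P0 : P I y != 0.
      by apply: contraNneq omega_neq0 => P0; rewrite -PI P0 scale0r.
    split=> //; rewrite /invT_eigen big_pred0 // mul1r expr0 invr1 mulr1.
    by rewrite -[in RHS]PI scalerA mulVf // scale1r.
  rewrite -mulmxA T_low ?mulmx0 // lt0n.
  by rewrite -(inj_eq val_inj) in neb.
have ltk : (k < n)%N by exact: ltnW.
set I := Ordinal lti; pose J := Ordinal ltk.
have PJ (a : 'I_n) z : (a < I)%N -> S z -> P a z != 0.
  by case: a => a lta /= ltaI Sz; case: (IH a ltaI lta z Sz).
have eJ0 z : S z -> invT_eigen J z != 0.
  move=> Sz; apply: mulf_neq0; last by rewrite invr_eq0 PJ //; exact: S_mulNX.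
  apply/prodf_neq0 => a lta; rewrite mulf_neq0 ?invr_eq0 // PJ //=;
    by [exact: ltnW | exact: S_mulNX].
have fus z : S z -> P I (z * q ^- I) *: (blk (invmx (T z)) I I *m omega)
    = (P J (z * q ^- I) * invT_eigen J z) *: omega.
  move=> Sz; have Sx : S (z * q ^- I) by exact: S_mulNX.
  have := @invTT_fusion z I J Sz erefl; rewrite /invTT /TinvT.
  rewrite T_diag // -scalemxAr => ->.
  have [_ ->] := IH k (ltnSn k) ltk z Sz.
  by rewrite -scalemxAr T_diag // scalerA mulrC.
(* The fusion identity at z q^I, rather than z, has P_I evaluated at z, and its right-hand side is
   nonzero by induction. *)
have PI z : S z -> P I z != 0.
  move=> Sz; have Sz' : S (z * q ^+ I) by exact: S_mulX.
  have := fus _ Sz'; rewrite mulfK ?expf_neq0 // => E.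
  have : (P J z * invT_eigen J (z * q ^+ I)) *: omega != 0.
    by rewrite scaler_eq0 (negPf omega_neq0) orbF mulf_neq0 ?PJ ?eJ0.
  by apply: contraNneq => P0; rewrite -E P0 scale0r.
split; first exact: PI.
have Py : P I (y * q ^- I) != 0 by apply: PI; exact: S_mulNX.
apply: (scalerI Py); rewrite fus // scalerA; congr (_ *: _).
(* The new factor a = J of the product is P_J(y q^-I) / P_J(y q^-J); its denominator is the last
   denominator of [invT_eigen J y]. *)
rewrite /invT_eigen [RHS]mulrCA divff // mulr1.
rewrite [RHS](bigD1 J) //= [LHS]mulrA [LHS]mulrAC; congr (_ * _).
apply: eq_bigl => a; rewrite ltnS -(inj_eq val_inj) /=.
by case: ltngtP.
Qed.

(** * Eigenvalues of T(x) K T(y)^-1 on omega for generic x / y *)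

Section Generic.
Variables x y : L.
Hypotheses (Sx : S x) (Sy : S y).
Let u := x / y.
Let u0 : u != 0. Proof. exact: ratio_neq0. Qed.
Hypothesis u_generic : forall k, q ^+ (2 * k) * u ^+ 2 != 1.

Let u21 : u ^+ 2 != 1.
Proof. by have := u_generic 0; rewrite mul1r. Qed.

(** Each term of the block product vanishes separately. For j < i one delta in [exchange_inv] is 0
    and T_il kills omega for l <= j, so the system is homogeneous: its weighted sums kill the total,
    then every partial sum, then each term. *)
Lemma T_invT_low (i j k : 'I_n) : (j < i)%N ->
  blk (T x) i k *m (blk (invmx (T y)) k j *m omega) = 0.
Proof.
move=> ltji; pose Y k := blk (T x) i k *m (blk (invmx (T y)) k j *m omega).
rewrite -/(Y k); case: (leqP k j) => [lekj|ltjk]; last first.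
  by rewrite /Y invT_low ?mulmx0.
have Ysys (l : 'I_n) : (l <= j)%N ->
    \sum_(g < n) exch q u g l *: Y g + fb u *: Y l = 0.
  move=> lelj; have := exchange_inv (T_unit Sy) (T_exchange Sx Sy) i l l j.
  rewrite eqxx -(inj_eq val_inj) (gtn_eqF ltji) /= mulr0n subr0 mulr1n.
  move=> /(congr1 (fun Z => Z *m omega)); rewrite -scalemxAl mulmxBl -!mulmxA.
  rewrite (T_low Sx (leq_ltn_trans lelj ltji)) mulmx0 sub0r -/(Y l).
  rewrite mulmx_suml => E; rewrite (_ : \sum_(g < n) _ = - (fb u *: Y l)).
    by rewrite addNr.
  rewrite -scalerN E; apply: eq_bigr => g _; rewrite -scalemxAl -mulmxA //.
have Ysum (l : nat) : (l <= j.+1)%N ->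
    (q ^+ (2 * l) / q * fb u) *: (\sum_(g < n | (g < l)%N) Y g)
    + (q^-1 * u^-1 * (q ^+ (2 * l) - 1)) *: (\sum_g Y g) = 0.
  move=> lelj; rewrite -exch_weight_sum ?(leq_trans lelj) // big1 // => g ltg.
  by rewrite Ysys ?scaler0 // -ltnS (leq_trans ltg).
have Y0 : \sum_g Y g = 0.
  have := Ysum _ (leqnn j.+1).
  rewrite [X in _ *: X + _](_ : _ = \sum_g Y g); last first.
    rewrite big_mkcond; apply: eq_bigr => g _; case: ltnP => // ltg.
    by rewrite /Y invT_low ?mulmx0.
  rewrite -scalerDl => /eqP; rewrite scaler_eq0 => /orP[|/eqP //].
  (* Here the partial sum is the total sum, and its combined coefficient is nonzero by
     genericity. *)
  rewrite (_ : _ + _ = q^-1 * u^-1 * (q ^+ (2 * j.+1) * u ^+ 2 - 1)).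
    by rewrite !mulf_eq0 !invr_eq0 (negPf q0) (negPf u0) subr_eq0 (negPf (u_generic _)).
  by rewrite /fb; move: (q ^+ _) => Q; field; rewrite u0.
have Yp (l : nat) : (l <= j.+1)%N -> \sum_(g < n | (g < l)%N) Y g = 0.
  move=> lelj; have := Ysum l lelj; rewrite Y0 scaler0 addr0 => /eqP.
  rewrite scaler_eq0 !mulf_eq0 invr_eq0 expf_eq0 (negPf q0) andbF.
  by rewrite (negPf (fb_neq0 u0 u21)) => /eqP.
have := Yp k.+1 lekj; rewrite (bigD1 k) //= => <-.
rewrite [X in _ + X](_ : _ = \sum_(g < n | (g < k)%N) Y g).
  by rewrite Yp ?addr0 // ltnW.
apply: eq_bigl => g; rewrite ltnS -(inj_eq val_inj) /=; by case: ltngtP.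
Qed.

Let u_generic0 k : q ^+ (2 * k) * u ^+ 2 - 1 != 0.
Proof. by rewrite subr_eq0. Qed.

(** The common eigenvalue of M_kk and L_kk; at x = z, y = 1/z it is P_k(z) hat P_k(1/z). *)
Definition lam (k : 'I_n) := P k x * invT_eigen k y.

Lemma TinvT_diag k : TinvT x y k k = lam k *: omega.
Proof.
by rewrite /TinvT (invT_diag k Sy).2 -scalemxAr T_diag // scalerA mulrC.
Qed.

Lemma invTT_diag k : invTT x y k k = lam k *: omega.
Proof. by rewrite /invTT T_diag // -scalemxAr (invT_diag k Sy).2 scalerA. Qed.

(* q^k b(u) / b(q^k u), the ratio of Gamma_(k+1) to alpha or beta. *)
Definition gam (k : nat) : L :=
  q ^+ (2 * k) * (u ^+ 2 - 1) / (q ^+ (2 * k) * u ^+ 2 - 1).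

(** The eigenvalue formula of the theorem with u^2 for z^4 and a free c_k for the alpha or beta
    factor of Gamma_k. The case c = 1 belongs to K = 1. *)
Definition beig (c : nat -> L) (i : 'I_n) : L :=
  gam i * c i * lam i
  + \sum_(k < n | (k < i)%N)
      (q ^+ 2 - 1) / (q ^+ (2 * k.+1) * u ^+ 2 - 1) * (gam k * c k * lam k).

Lemma ltn_sum_ord (V : nmodType) (F : 'I_n -> V) (i : nat) (j : 'I_n) : i = j.+1 ->
  \sum_(k < n | (k < i)%N) F k = F j + \sum_(k < n | (k < j)%N) F k.
Proof.
move=> ij; rewrite (bigD1 j) /= ?ij //; congr (_ + _); apply: eq_bigl => k.
by rewrite ltnS -(inj_eq val_inj) /=; case: ltngtP.
Qed.

(** By [TinvT_step] the increment from j = i - 1 to i is gam_i (lam_i - lam_j). The formula has the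
    same increment because gam_j (1 - (q^2 - 1) / (q^(2i) u^2 - 1)) = gam_i. *)
Lemma TinvT_sum i : \sum_k TinvT x y i k = beig (fun=> 1) i *: omega.
Proof.
case: i => i lti; elim: i lti => [|j IH] lti.
  rewrite /beig /gam [X in _ + X]big_pred0 // muln0 expr0 mul1r.
  rewrite (bigD1 (Ordinal lti)) //= big1.
    rewrite mul1r divff; last by have := u_generic0 0; rewrite expr0 mul1r.
    by rewrite !mul1r !addr0 TinvT_diag.
  move=> k ne; rewrite (TinvT_trig _ Sy) // lt0n; by rewrite -(inj_eq val_inj) in ne.
have ltj : (j < n)%N by exact: ltnW.
pose J := Ordinal ltj; pose I := Ordinal lti; rewrite -/I.
have := TinvT_step Sx Sy (erefl : I = J.+1 :> nat).
rewrite -/u (IH ltj) -/J TinvT_diag invTT_diag -scalerBl scalerA => E.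
apply: (scalerI (u_generic0 I)); rewrite -[LHS](subrK (
  (q ^+ (2 * I) * u ^+ 2 - 1) *: (beig (fun=> 1) J *: omega))) -scalerBr E.
rewrite !scalerA -scalerDl; congr (_ *: _).
rewrite /beig (ltn_sum_ord _ (erefl : I = J.+1 :> nat)) /gam /=.
have := u_generic0 j; have := u_generic0 j.+1.
move: (\sum_(k < n | _) _) (lam I) (lam J) => s lI lJ.
rewrite mulnS exprD; move: (q ^+ (2 * j)) => Q h1 h2.
by field; rewrite h1 h2.
Qed.

(** For i >= m > 0 the sum is be m_i plus (u^2 - 1) times the partial sum of the M_ik over k < m,
    and [TinvT_partial_sum] computes exactly that multiple. It contributes -(1 - q^(-2m)) m_i,
    whence the shifted coefficient be - 1 + q^(-2m). *)
Lemma TinvT_weighted_sum (c : nat -> L) (m : nat) (al be : L) i :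
  (m <= n)%N -> al - be = u ^+ 2 - 1 ->
  (forall k, c k = if (k < m)%N then al else be - 1 + q ^- (2 * m)) ->
  \sum_(k < n) (if (k < m)%N then al else be) *: TinvT x y i k
  = beig c i *: omega.
Proof.
move=> lemn albe cE.
have beig_split s (K : 'I_n) t : (forall k : 'I_n, (k <= K)%N -> c k = s) ->
    t = s -> beig c K = t * beig (fun=> 1) K.
  move=> cs ->; rewrite /beig mulrDr mulr_sumr cs // mulr1; congr (_ + _).
    by ring.
  by apply: eq_bigr => k ltk; rewrite cs 1?ltnW // mulr1; ring.
have [ltim|lemi] := ltnP i m.
  rewrite (@beig_split al i al) // => [|k leki]; last first.
    by rewrite cE (leq_ltn_trans leki).
  rewrite -scalerA -TinvT_sum scaler_sumr; apply: eq_bigr => k _.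
  case: (leqP k i) => [leki|/(TinvT_trig _ Sy) ->]; last by rewrite !scaler0.
  by rewrite (leq_ltn_trans leki).
(* Without alpha entries the shift q^(-2m) - 1 is 0 and K is a scalar. *)
case: m => [|m] in lemn cE lemi *.
  rewrite (@beig_split be i be) // => [|k leki]; last first.
    by rewrite cE expr0 invr1 subrK.
  by rewrite -scalerA -TinvT_sum scaler_sumr.
pose J := Ordinal lemn; have := @TinvT_partial_sum x y Sx Sy i J lemi.
rewrite -/u invTT_diag !TinvT_sum /= => E.
have u210 : u ^+ 2 - 1 != 0 by rewrite subr_eq0.
have -> : \sum_(k < n) (if (k < m.+1)%N then al else be) *: TinvT x y i k
   = be *: \sum_k TinvT x y i k
     + (u ^+ 2 - 1) *: \sum_(k < n | (k <= m)%N) TinvT x y i k.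
  rewrite !scaler_sumr [X in _ + X]big_mkcond -big_split /=.
  apply: eq_bigr => k _; rewrite ltnS; case: ifP => _; last by rewrite addr0.
  by rewrite -scalerDl -albe addrC subrK.
have Q0 : q ^+ (2 * m.+1) != 0 by rewrite expf_neq0.
set s := \sum_(k < n | (k <= m)%N) TinvT x y i k in E *.
have -> : (u ^+ 2 - 1) *: s
   = ((u ^+ 2 - 1) * (beig (fun=> 1) J - lam J)
      + (1 - q ^- (2 * m.+1)) * (beig (fun=> 1) J - beig (fun=> 1) i)) *: omega.
  move: (beig _ J) (beig _ i) (lam J) (q ^+ _) Q0 E => b b' l Q Q0 E.
  apply: (scalerI Q0); apply/matrixP => r t; move/matrixP/(_ r t): E.
  rewrite !mxE; move: (s r t) (omega r t) => {}s w E; apply/eqP.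
  rewrite -subr_eq0; move/eqP: E; rewrite -subr_eq0 => /eqP <-; apply/eqP.
  by field.
rewrite TinvT_sum scalerA -scalerDl; congr (_ *: _).
pose r (k : 'I_n) := (q ^+ 2 - 1) / (q ^+ (2 * k.+1) * u ^+ 2 - 1)
  * (gam k * 1 * lam k).
set be' := be - 1 + _ in cE.
(* Relative to the constant coefficient be', only the terms k <= J < i have a different c_k, namely
   al. *)
have -> : beig c i = be' * beig (fun=> 1) i
   + (al - be') * \sum_(k < n | (k < m.+1)%N) r k.
  rewrite /beig cE ltnNge lemi /= [X in _ = X + _]mulrDr -[RHS]addrA; congr (_ + _).
    by ring.
  rewrite !mulr_sumr [X in _ = _ + X](_ : _ = \sum_(k < n | (k < i)%N)
     if (k < m.+1)%N then (al - be') * r k else 0).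
    rewrite -big_split; apply: eq_bigr => k _ /=; rewrite cE /r.
    by case: ifP => _; ring.
  rewrite -big_mkcondr; apply: eq_bigl => k.
  by case: (ltnP k m.+1) => [ltk|_]; rewrite ?andbF // (leq_trans ltk).
rewrite (ltn_sum_ord _ (erefl : m.+1 = J.+1 :> nat)).
rewrite [beig _ J](_ : _ = gam J * lam J + \sum_(k < n | (k < J)%N) r k); last first.
  by rewrite /beig mulr1.
rewrite /r /be' /gam /=; have := u_generic0 m; have := u_generic0 m.+1.
move: (\sum_(k < n | _) _) (beig _ i) (lam J) => t b l.
have -> : al = be + (u ^+ 2 - 1) by rewrite -albe addrC subrK.
have := expf_neq0 (2 * m) q0; rewrite mulnS exprD.
move: (q ^+ (2 * m)) => Q {}Q0 h1 h2.
by field; rewrite h1 h2 q0 Q0.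
Qed.


End Generic.
End HighestWeight.

(** * Evaluation of rational functions at transcendental points *)

Section GenericPoints.
Variables (C F : fieldType) (iota : {rmorphism C -> F}).
Implicit Types (x : F) (p g : {poly C}).

Definition transc x := forall p, p != 0 -> (map_poly iota p).[x] != 0.

Lemma transc_comp g x : (1 < size g)%N -> transc x -> transc (map_poly iota g).[x].
Proof.
move=> sg tx p p0; rewrite -horner_comp -map_comp_poly tx //.
by rewrite comp_poly_eq0.
Qed.

Lemma transc_mul c x : c != 0 -> transc x -> transc (x * iota c).
Proof.
move=> c0 tx; have := @transc_comp (c *: 'X) x.
by rewrite size_scale // size_polyX map_polyZ map_polyX hornerZ hornerX mulrC; exact.
Qed.

Lemma transc_exp k x : transc x -> transc (x ^+ k.+1).
Proof.
move=> tx; have := @transc_comp 'X^(k.+1) x.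
by rewrite size_polyXn map_polyXn hornerXn; exact.
Qed.

Lemma transc_neq0 x : transc x -> x != 0.
Proof. by move=> /(_ 'X); rewrite polyX_eq0 map_polyX hornerX; exact. Qed.

(** If 1/x were a root of p, then x would be a root of the reversed polynomial r, whose constant
    term is the leading coefficient of p. *)
Lemma transc_inv x : transc x -> transc x^-1.
Proof.
move=> tx p p0; have x0 := transc_neq0 tx.
pose r := \poly_(i < size p) p`_(size p - i.+1).
have r0 : r != 0.
  apply: contraNneq p0 => /(congr1 (fun s : {poly C} => s`_0)).
  rewrite coef_poly coef0; case: ltnP => [lt|]; last by rewrite leqn0 size_poly_eq0.
  by rewrite subn1 => /eqP; rewrite -/(lead_coef p) lead_coef_eq0.
apply: contraNneq (tx r r0) => px.
have -> : (map_poly iota r).[x] = x ^+ (size p).-1 * (map_poly iota p).[x^-1].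
  rewrite [X in _ = _ * X]horner_coef size_map_poly mulr_sumr.
  have -> : map_poly iota r = \poly_(i < size p) iota p`_(size p - i.+1).
    by apply/polyP => i; rewrite coef_map /r !coef_poly /=; case: ifP; rewrite ?rmorph0.
  rewrite horner_poly.
  rewrite (reindex_inj rev_ord_inj) /=; apply: eq_bigr => i _.
  have lti := ltn_ord i.
  rewrite subnSK // subKn 1?ltnW // coef_map /= mulrCA; congr (_ * _).
  rewrite exprVn -[(size p).-1](@subnK i) 1?exprD ?mulfK ?expf_neq0 //.
    by rewrite -subn1 subnAC subn1 -subnS.
  by rewrite -ltnS prednK // (leq_trans _ lti).
by rewrite px mulr0.
Qed.

Definition ev x : {rmorphism {poly C} -> F} :=
  horner_morph (fun a => mulrC x (iota a)).

Lemma evE x p : ev x p = (map_poly iota p).[x].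
Proof. by []. Qed.

Lemma ratfunE (f : ratfun C) :
  f * tofrac \d_(repr f) = tofrac \n_(repr f).
Proof.
rewrite -{1}[f]reprK; set x := repr f.
have d0 : \d_x != 0 by exact: denom_ratioP.
unlock FracField.tofrac.
rewrite -[LHS]FracField.pi_mul; apply/eqmodP.
rewrite /= /equivf /FracField.mulf !numden_Ratio ?mulf_neq0 ?oner_eq0 //.
by rewrite !(mulr1, mul1r) mulrC.
Qed.

(** Two fractions for f cross-multiply to a polynomial identity, which survives evaluation;
    transcendence of x keeps both denominators nonzero. *)
Lemma rat_eval_unique x (f : ratfun C) p g : transc x -> g != 0 ->
  f * tofrac g = tofrac p -> rat_eval iota f x = ev x p / ev x g.
Proof.
move=> tx g0 fE; have d0 : \d_(repr f) != 0 by exact: denom_ratioP.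
rewrite /rat_eval -!evE; apply/eqP; rewrite eqr_div ?tx // -!rmorphM /=.
apply/eqP; congr (ev x _); apply/eqP; rewrite -tofrac_eq !tofracM -fE -ratfunE.
by apply/eqP; ring.
Qed.

Lemma rat_eval_tofrac x p : transc x -> rat_eval iota (tofrac p) x = ev x p.
Proof.
move=> tx; rewrite (@rat_eval_unique _ _ p 1) ?oner_eq0 //.
  by rewrite rmorph1 divr1.
by rewrite rmorph1 mulr1.
Qed.

(** At a transcendental point evaluation is a field morphism, so unit matrices and block identities
    can be carried over to it. *)
Lemma rat_eval_morphism x : transc x ->
  exists2 s : {rmorphism ratfun C -> F},
    (forall f, s f = rat_eval iota f x) & forall p, s (tofrac p) = ev x p.
Proof.
move=> tx; have d0 (f : ratfun C) : \d_(repr f) != 0 by exact: denom_ratioP.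
pose s f := rat_eval iota f x.
have sB : zmod_morphism s.
  move=> f g; rewrite /s (@rat_eval_unique _ (f - g)
    (\n_(repr f) * \d_(repr g) - \n_(repr g) * \d_(repr f))
    (\d_(repr f) * \d_(repr g))) ?mulf_neq0 //; last first.
    by rewrite rmorphB !rmorphM /= -!ratfunE; ring.
  rewrite /rat_eval -!evE rmorphB !rmorphM /=.
  by field; rewrite !tx ?d0.
have sM : monoid_morphism s.
  split=> [|f g].
    by rewrite /s -[1]tofrac1 rat_eval_tofrac // rmorph1.
  rewrite /s (@rat_eval_unique _ (f * g)
    (\n_(repr f) * \n_(repr g)) (\d_(repr f) * \d_(repr g))) ?mulf_neq0 //;
    last by rewrite !rmorphM /= -!ratfunE; ring.
  rewrite /rat_eval -!evE !rmorphM /=.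
  by field; rewrite !tx ?d0.
pose sb := GRing.isZmodMorphism.Build _ _ s sB.
pose sm := GRing.isMonoidMorphism.Build _ _ s sM.
pose t : {rmorphism ratfun C -> F} := HB.pack s sb sm.
by exists t => // p; exact: rat_eval_tofrac.
Qed.

End GenericPoints.

Section Zvar.
Variable C : fieldType.

Lemma ev_zvar (p : {poly C}) : ev (cst C) (zvar C) p = tofrac p.
Proof.
rewrite evE (map_poly_comp (@tofrac {poly C}) (@polyC C)) horner_map /=.
by rewrite -[in RHS](comp_polyXr p).
Qed.

Lemma transc_zvar : transc (cst C) (zvar C).
Proof. by move=> p p0; rewrite -evE ev_zvar tofrac_eq0. Qed.

End Zvar.

(** * The independent variables z and w of C(z)(w) *)

Section Zvar2.
Variable C : fieldType.

Lemma ev_zvar2 (p : {poly C}) :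
  ev (cst2 C) (zvar2 C) p = tofrac (tofrac p)%:P.
Proof.
rewrite evE (map_poly_comp (@tofrac {poly ratfun C} \o @polyC _) (cst C)).
by rewrite horner_map /= -evE ev_zvar.
Qed.

Lemma ev_wvar2 (p : {poly C}) :
  ev (cst2 C) (wvar2 C) p = tofrac (map_poly (cst C) p).
Proof.
rewrite evE (map_poly_comp (@tofrac {poly ratfun C} \o @polyC _) (cst C)).
exact: ev_zvar.
Qed.

Lemma transc_zvar2 : transc (cst2 C) (zvar2 C).
Proof. by move=> p p0; rewrite -evE ev_zvar2 tofrac_eq0 polyC_eq0 tofrac_eq0. Qed.

Lemma transc_wvar2 : transc (cst2 C) (wvar2 C).
Proof. by move=> p p0; rewrite -evE ev_wvar2 tofrac_eq0 map_poly_eq0. Qed.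

Definition ev2 (F : fieldType) (iota : {rmorphism C -> F}) (x y : F)
    : {rmorphism {poly {poly C}} -> F} :=
  horner_morph (fun a => mulrC y (ev iota x a)).

Lemma ev2C (F : fieldType) (iota : {rmorphism C -> F}) (x y : F) p :
  ev2 iota x y p%:P = ev iota x p.
Proof. exact: horner_morphC. Qed.

Lemma ev2_map (F : fieldType) (iota : {rmorphism C -> F}) (x y : F) p :
  ev2 iota x y (map_poly polyC p) = ev iota y p.
Proof.
rewrite -[LHS]/(_.[y]) -map_poly_comp evE; congr _.[y].
by apply: eq_map_poly => a /=; exact: horner_morphC.
Qed.

(** Evaluation at (z, w) is the coefficientwise embedding of C[z][w] into C(z)(w): z and w are
    algebraically independent. *)
Lemma ev2_inj (p : {poly {poly C}}) : ev2 (cst2 C) (zvar2 C) (wvar2 C) p = 0 -> p = 0.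
Proof.
have -> : ev2 (cst2 C) (zvar2 C) (wvar2 C) p = tofrac (map_poly (@tofrac _) p).
  rewrite -[RHS]ev_zvar evE -map_poly_comp -[LHS]/(_.[_]).
  by congr _.[_]; apply: eq_map_poly => a; rewrite -/(ev _ _) ev_zvar2.
move=> /eqP; rewrite tofrac_eq0 => /eqP p0; apply/polyP => i.
by apply/eqP; rewrite coef0 -tofrac_eq0 -coef_map p0 coef0.
Qed.

End Zvar2.

(** * From the matrix RTT relation to its entries *)

Section Components.
Variables (L : fieldType) (n d : nat).
Implicit Types X Y : 'M[L]_(n * d).

Lemma sum_offdiag (V : nmodType) (G : 'I_n -> 'I_n -> V) (a b : 'I_n) :
  (forall a' b', (a' != a) || (b' != b) -> G a' b' = 0) ->
  \sum_(a' < n) \sum_(b' < n | b' != a') G a' b' = G a b *+ (a != b).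
Proof.
move=> G0; rewrite (bigD1 a) //= [X in _ + X]big1 ?addr0 => [|a' ne].
  rewrite big_mkcond (bigD1 b) //= big1 ?addr0 => [|b' ne].
    by rewrite eq_sym; case: (a != b).
  by rewrite G0 ?ne ?orbT // if_same.
by rewrite big1 // => b' _; rewrite G0 ?ne.
Qed.

(** For a = b the two index conditions coincide and b(z) + (a(z) - b(z)) = a(z); this is why [exch]
    has that diagonal value. *)
Lemma RmxE (q z : L) (a b c e : 'I_n) :
  Rmx n q z (mxtens_index (a, b)) (mxtens_index (c, e))
  = fb z *+ ((a == c) && (b == e)) + exch q z a b *+ ((a == e) && (b == c)).
Proof.
have delta0 (a' c' : 'I_n) b' e' : (a' != a) || (b' != b) ->
    (delta_mx a' c' *t delta_mx b' e' : 'M[L]_(n * n))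
      (mxtens_index (a, b)) (mxtens_index (c, e)) = 0.
  rewrite tensmxE !mxE [a == _]eq_sym [b == _]eq_sym.
  by case/orP => /negPf ->; rewrite ?mul0r ?mulr0.
have deltaE (c' e' : 'I_n) :
    (delta_mx a c' *t delta_mx b e' : 'M[L]_(n * n))
      (mxtens_index (a, b)) (mxtens_index (c, e)) = ((c == c') && (e == e'))%:R.
  by rewrite tensmxE !mxE !eqxx /= -natrM mulnb.
rewrite /Rmx !mxE.
have -> : (\sum_(a' < n) delta_mx a' a' *t delta_mx a' a' : 'M[L]_(n * n))
     (mxtens_index (a, b)) (mxtens_index (c, e))
   = ((a == c) && (b == e) && (a == b))%:R.
  rewrite summxE (bigD1 a) //= [X in _ + X]big1 ?addr0 => [|a' ne]; last first.
    by rewrite delta0 ?ne.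
  have [ab|neab] := eqVneq a b; last by rewrite andbF delta0 // neab orbT.
  rewrite (_ : delta_mx a a *t delta_mx a a = delta_mx a a *t delta_mx b b).
    by rewrite deltaE andbT [c == _]eq_sym [e == _]eq_sym.
  by rewrite ab.
have -> : (\sum_(a' < n) \sum_(b' < n | b' != a')
    delta_mx a' a' *t delta_mx b' b' : 'M[L]_(n * n))
     (mxtens_index (a, b)) (mxtens_index (c, e))
   = ((a == c) && (b == e) && (a != b))%:R.
  rewrite summxE; under eq_bigr do rewrite summxE.
  rewrite (@sum_offdiag _ _ a b) => [|a' b' ne]; last by rewrite delta0.
  by rewrite deltaE -mulrnA mulnb [c == _]eq_sym [e == _]eq_sym.
rewrite summxE; under eq_bigr do rewrite summxE.
under eq_bigr do under eq_bigr do rewrite mxE.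
rewrite (@sum_offdiag _ _ a b) => [|a' b' ne]; last by rewrite delta0 ?mulr0.
rewrite deltaE /exch [e == a]eq_sym [c == b]eq_sym.
rewrite [(b == c) && (a == e)]andbC.
case: (ltngtP a b) => [ltab|ltba|/val_inj ab].
- have ne : a != b by rewrite -(inj_eq val_inj) (ltn_eqF ltab).
  rewrite ?ne ?(negPf ne) ?andbT ?andbF.
  have -> : sgz (b%:Z - a%:Z) = 1 by rewrite gtr0_sgz // subr_gt0.
  rewrite expr1z /=.
  by case: (_ && _); case: (_ && _); rewrite /= ?(mulr0n, mulr1n); ring.
- have ne : a != b by rewrite -(inj_eq val_inj) (gtn_eqF ltba).
  rewrite ?ne ?(negPf ne) ?andbT ?andbF.
  have -> : sgz (b%:Z - a%:Z) = -1 by rewrite ltr0_sgz // subr_lt0.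
  rewrite exprN1 /=.
  by case: (_ && _); case: (_ && _); rewrite /= ?(mulr0n, mulr1n); ring.
- rewrite -ab eqxx /= andbF andbT [a == e]eq_sym [a == c]eq_sym.
  rewrite [(e == a) && _]andbC mulr0n !mulr0 !addr0.
  by case: (_ && _); rewrite /= ?(mulr0n, mulr1n); ring.
Qed.

Lemma blk_scalar_tens (X : 'M[L]_n) (a b : 'I_n) :
  blk (X *t (1%:M : 'M_d)) a b = X a b *: 1%:M.
Proof.
by apply/matrixP => k l; rewrite mxE tensmxE !mxE.
Qed.

Lemma blk_leg1 X (a b c e : 'I_n) :
  blk (leg1 X) (mxtens_index (a, b)) (mxtens_index (c, e)) = blk X a c *+ (b == e).
Proof.
apply/matrixP => k l; rewrite mxE summxE (bigD1 a) //=.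
rewrite [X in _ + X]big1 ?addr0 => [|a' ne]; last first.
  rewrite summxE big1 // => c' _; rewrite !tensmxE !mxE.
  by rewrite eq_sym (negPf ne) /= !mul0r.
rewrite summxE (bigD1 c) //= [X in _ + X]big1 ?addr0 => [|c' ne]; last first.
  by rewrite !tensmxE !mxE [c == _]eq_sym (negPf ne) andbF !mul0r.
rewrite !tensmxE !mxE !eqxx mul1r.
by case: (b == e); rewrite ?mul1r ?mul0r ?mulr0n ?mulr1n !mxE.
Qed.

Lemma blk_leg2 X (a b c e : 'I_n) :
  blk (leg2 X) (mxtens_index (a, b)) (mxtens_index (c, e)) = blk X b e *+ (a == c).
Proof.
apply/matrixP => k l; rewrite mxE summxE (bigD1 b) //=.
rewrite [X in _ + X]big1 ?addr0 => [|a' ne]; last first.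
  rewrite summxE big1 // => c' _; rewrite !tensmxE !mxE.
  by rewrite [b == _]eq_sym (negPf ne) /= mulr0 mul0r.
rewrite summxE (bigD1 e) //= [X in _ + X]big1 ?addr0 => [|c' ne]; last first.
  by rewrite !tensmxE !mxE [e == _]eq_sym (negPf ne) andbF mulr0 mul0r.
rewrite !tensmxE !mxE !eqxx mulr1.
by case: (a == c); rewrite ?mul1r ?mul0r ?mulr0n ?mulr1n !mxE.
Qed.

End Components.

Lemma RTT_exchange (L : fieldType) (n d : nat) (q u : L) (A B : 'M[L]_(n * d)) :
  let Ru := Rmx n q u *t (1%:M : 'M_d) in
  Ru *m (leg1 A *m leg2 B) = leg2 B *m leg1 A *m Ru -> exchange q u A B.
Proof.
move=> Ru RTT a b c e.
have AB a' b' : blk (leg1 A *m leg2 B) (mxtens_index (a', b')) (mxtens_index (c, e))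
    = blk A a' c *m blk B b' e.
  rewrite blkM sum_mxtens (bigD1 c) //= (bigD1 b') //= blk_leg1 blk_leg2 !eqxx.
  rewrite !big1 ?addr0 // => [c' ne|b'' ne].
    by rewrite big1 // => b'' _; rewrite blk_leg2 (negPf ne) mulr0n mulmx0.
  by rewrite blk_leg1 eq_sym (negPf ne) mulr0n mul0mx.
have BA c' e' : blk (leg2 B *m leg1 A) (mxtens_index (a, b)) (mxtens_index (c', e'))
    = blk B b e' *m blk A a c'.
  rewrite blkM sum_mxtens (bigD1 a) //= (bigD1 e') //= blk_leg1 blk_leg2 !eqxx.
  rewrite !big1 ?addr0 // => [a' ne|b'' ne].
    by rewrite big1 // => b'' _; rewrite blk_leg2 eq_sym (negPf ne) mulr0n mul0mx.
  by rewrite blk_leg1 (negPf ne) mulr0n mulmx0.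
have := congr1 (fun X => blk X (mxtens_index (a, b)) (mxtens_index (c, e))) RTT.
rewrite !blkM !sum_mxtens.
under eq_bigr do under eq_bigr do
  rewrite blk_scalar_tens RmxE AB -scalemxAl mul1mx scalerDl.
under [in X in _ = X -> _]eq_bigr do under eq_bigr do
  rewrite blk_scalar_tens RmxE BA -scalemxAr mulmx1 scalerDl.
(* Each of the four double sums has a single surviving index pair. *)
have pick (V : 'I_n -> 'I_n -> 'M[L]_d) (w : 'I_n -> 'I_n -> L) (i j : 'I_n)
    (k : 'I_n -> 'I_n -> bool) :
    (forall i' j', k i' j' = (i' == i) && (j' == j)) ->
    \sum_i' \sum_j' (w i' j' *+ k i' j') *: V i' j' = w i j *: V i j.
  move=> kE; rewrite (bigD1 i) //= (bigD1 j) //= kE !eqxx /=.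
  rewrite !big1 ?addr0 // => [i' ne|j' ne].
    by rewrite big1 // => j' _; rewrite kE (negPf ne) scale0r.
  by rewrite kE (negPf ne) andbF scale0r.
under eq_bigr do rewrite big_split.
under [in X in _ = X -> _]eq_bigr do rewrite big_split.
rewrite !big_split /=.
rewrite (pick (fun i j => blk A i c *m blk B j e) (fun _ _ => fb u) a b
  (fun i j => (a == i) && (b == j))) => [|i j]; last first.
  by rewrite eq_sym [b == _]eq_sym.
rewrite (pick (fun i j => blk A i c *m blk B j e) (fun _ _ => exch q u a b) b a
  (fun i j => (a == j) && (b == i))) => [|i j]; last first.
  by rewrite andbC eq_sym [a == _]eq_sym.
rewrite (pick (fun i j => blk B b j *m blk A a i) (fun _ _ => fb u) c e
  (fun i j => (i == c) && (j == e))) //.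
rewrite (pick (fun i j => blk B b j *m blk A a i) (fun i j => exch q u i j) e c
  (fun i j => (i == e) && (j == c))) // scalerBr => E.
by apply/eqP; rewrite subr_eq addrAC -subr_eq opprK E addrC.
Qed.

Lemma exchangeZ (L : fieldType) (n d : nat) (q u s t : L) (A B : 'M[L]_(n * d)) :
  exchange q u A B -> exchange q u (s *: A) (t *: B).
Proof.
move=> AB a b c e; move: (AB a b c e); rewrite !blkZ -!scalemxAl -!scalemxAr.
move: (_ *m _) (_ *m _) (_ *m _) (_ *m _) => W X Y Z E.
apply/matrixP => k l; move/matrixP/(_ k l): E; rewrite !mxE => E.
transitivity (s * t * (fb u * (Z k l - Y k l))); first by ring.
by rewrite E; ring.
Qed.

(** * The exchange relation with denominators cleared *)

Section Polynomial.
Variables (n d : nat).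

(** The block of [blk] for entries outside a field, such as polynomials. *)
Definition pblk (A : nmodType) (X : 'M[A]_(n * d)) (a b : 'I_n) : 'M[A]_d :=
  mxsub (fun k => mxtens_index (a, k)) (fun k => mxtens_index (b, k)) X.

(** This is z w times [exch] at u = z / w, for qV = q^-1. *)
Definition pexch (A : comPzRingType) (q qV z w : A) (a b : nat) : A :=
  if (a < b)%N then (q - qV) * z ^+ 2
  else if (b < a)%N then (q - qV) * w ^+ 2
  else (q - 1) * z ^+ 2 - (qV - 1) * w ^+ 2.

(* z w times the defect of [exchange] for u = z / w (with qV = q^-1): unlike the
   relation itself it makes sense over polynomials, and so can be specialized. *)
Definition exchange_defect (A : comPzRingType) (q qV z w : A)
    (X Y : 'M[A]_(n * d)) (a b c e : 'I_n) : 'M[A]_d :=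
  (z ^+ 2 - w ^+ 2) *: (pblk X a c *m pblk Y b e - pblk Y b e *m pblk X a c)
  - (pexch q qV z w e c *: (pblk Y b c *m pblk X a e)
     - pexch q qV z w a b *: (pblk X b c *m pblk Y a e)).

Lemma map_exchange_defect (A B : comPzRingType) (f : {rmorphism A -> B})
    (q qV z w : A) X Y a b c e :
  map_mx f (exchange_defect q qV z w X Y a b c e)
  = exchange_defect (f q) (f qV) (f z) (f w) (map_mx f X) (map_mx f Y) a b c e.
Proof.
have pexchE i j : f (pexch q qV z w i j) = pexch (f q) (f qV) (f z) (f w) i j.
  rewrite /pexch; case: ifP => _; last case: ifP => _.
  - by rewrite rmorphM rmorphB rmorphXn.
  - by rewrite rmorphM rmorphB rmorphXn.
  - by rewrite rmorphB !rmorphM !rmorphB rmorph1.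
rewrite /exchange_defect !(map_mxB, map_mxZ) !map_mxM !pexchE.
rewrite rmorphB !rmorphXn.
by rewrite /pblk !map_mxsub.
Qed.

Lemma exchange_defectP (L : fieldType) (q z w : L) (X Y : 'M[L]_(n * d)) :
  z != 0 -> w != 0 ->
  (exchange q (z / w) X Y
   <-> forall a b c e, exchange_defect q q^-1 z w X Y a b c e = 0).
Proof.
move=> z0 w0; have blkE (Z : 'M[L]_(n * d)) a b : pblk Z a b = blk Z a b.
  by apply/matrixP => k l; rewrite !mxE.
have fbE : (z * w) * fb (z / w) = z ^+ 2 - w ^+ 2.
  by rewrite /fb; field; rewrite z0 w0.
have exchE i j : (z * w) * exch q (z / w) i j = pexch q q^-1 z w i j.
  rewrite /exch /pexch /fa /fb invf_div; case: ifP => _; last case: ifP => _.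
  - by move: (q^-1) => v; field; rewrite ?z0 ?w0.
  - by move: (q^-1) => v; field; rewrite ?z0 ?w0.
  - by move: (q^-1) => v; field; rewrite z0 w0.
have defectE a b c e : exchange_defect q q^-1 z w X Y a b c e = (z * w) *:
   (fb (z / w) *: (blk X a c *m blk Y b e - blk Y b e *m blk X a c)
    - (exch q (z / w) e c *: (blk Y b c *m blk X a e)
      - exch q (z / w) a b *: (blk X b c *m blk Y a e))).
  by rewrite /exchange_defect !blkE -fbE -!exchE !scalerBr !scalerA.
split=> [XY a b c e|XY a b c e].
  by rewrite defectE XY subrr scaler0.
have /eqP := XY a b c e; rewrite defectE scaler_eq0 mulf_eq0 (negPf z0) (negPf w0).
by rewrite /= subr_eq0 => /eqP.
Qed.

End Polynomial.

(** * Specialization of the two-variable relation, and density *)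

Section Specialization.
Variables (C : fieldType).

Lemma common_denominator (r s : nat) (T : 'M[ratfun C]_(r, s)) :
  exists (D : {poly C}) (N : 'M[{poly C}]_(r, s)), D != 0
    /\ tofrac D *: T = map_mx (@tofrac {poly C}) N.
Proof.
pose den (k : 'I_r * 'I_s) := \d_(repr (T k.1 k.2)).
exists (\prod_k den k).
exists (\matrix_(i, j) (\n_(repr (T i j)) * \prod_(k | k != (i, j)) den k)).
split; first by apply/prodf_neq0 => k _; exact: denom_ratioP.
apply/matrixP => i j; rewrite !mxE (bigD1 (i, j)) //= !rmorphM /= -ratfunE /den /=.
by ring.
Qed.

Lemma mx_eval_numerator (F : fieldType) (iota : {rmorphism C -> F}) (x : F)
    (r s : nat) (T : 'M[ratfun C]_(r, s)) D N : transc iota x ->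
  tofrac D *: T = map_mx (@tofrac {poly C}) N ->
  ev iota x D *: mx_eval iota T x = map_mx (ev iota x) N.
Proof.
move=> /rat_eval_morphism[f fE fp] TE; apply/matrixP => i j; rewrite !mxE -fE -!fp.
by rewrite -rmorphM; move/matrixP/(_ i j): TE; rewrite !mxE => ->.
Qed.

Variables (n d : nat) (q : C) (T : 'M[ratfun C]_(n * d)).

(** The inner variable stands for z and the outer one for w, as in [ev2]. *)
Let defect (N : 'M[{poly C}]_(n * d)) a b c e : 'M[{poly {poly C}}]_d :=
  exchange_defect q%:P%:P (q^-1)%:P%:P 'X%:P 'X
    (map_mx polyC N) (map_mx (map_poly polyC) N) a b c e.

Lemma map_defect (F : fieldType) (iota : {rmorphism C -> F}) (x y : F) N a b c e :
  map_mx (ev2 iota x y) (defect N a b c e)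
  = exchange_defect (iota q) (iota q)^-1 x y
      (map_mx (ev iota x) N) (map_mx (ev iota y) N) a b c e.
Proof.
rewrite map_exchange_defect !ev2C !evE !map_polyC !hornerC map_polyX hornerX.
rewrite /= fmorphV; congr exchange_defect.
- by rewrite /ev2 horner_morphX.
- by apply/matrixP => i j; rewrite !mxE ev2C.
- by apply/matrixP => i j; rewrite !mxE ev2_map.
Qed.

(** RTT makes the defect of the numerators vanish at the independent pair (z, w), hence identically.
    It can then be evaluated at any transcendental x and y, even dependent ones such as z and
    1/z. *)
Lemma exchange_specialize (F : fieldType) (iota : {rmorphism C -> F}) (x y : F) :
  RTT q T -> transc iota x -> transc iota y ->
  exchange (iota q) (x / y) (mx_eval iota T x) (mx_eval iota T y).
Proof.
move=> /RTT_exchange RTT tx ty; have [D [N [D0 TE]]] := common_denominator T.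
have defect0 a b c e : defect N a b c e = 0.
  apply/matrixP => k l; rewrite [RHS]mxE; apply: ev2_inj.
  have := exchangeZ (ev (cst2 C) (zvar2 C) D) (ev (cst2 C) (wvar2 C) D) RTT.
  rewrite (mx_eval_numerator (@transc_zvar2 C) TE).
  rewrite (mx_eval_numerator (@transc_wvar2 C) TE).
  move/(exchange_defectP _ _ _ (transc_neq0 (@transc_zvar2 C))
    (transc_neq0 (@transc_wvar2 C)))/(_ a b c e).
  by rewrite -map_defect => /matrixP/(_ k l); rewrite !mxE.
have evD0 z : transc iota z -> ev iota z D != 0 by move=> tz; exact: tz.
have -> : mx_eval iota T x = (ev iota x D)^-1 *: map_mx (ev iota x) N.
  by rewrite -(mx_eval_numerator tx TE) scalerK ?evD0.
have -> : mx_eval iota T y = (ev iota y D)^-1 *: map_mx (ev iota y) N.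
  by rewrite -(mx_eval_numerator ty TE) scalerK ?evD0.
apply: exchangeZ; apply/exchange_defectP; [exact: transc_neq0 tx| exact: transc_neq0 ty|].
by move=> a b c e; rewrite -map_defect defect0 raddf0.
Qed.

Lemma linear_mx_sum (R : pzRingType) (V : lmodType R) (r s : nat)
    (f : 'M[R]_(r, s) -> V) : linear f ->
  forall X, f X = \sum_i \sum_j X i j *: f (delta_mx i j).
Proof.
move=> lf X; have fZ c Y : f (c *: Y) = c *: f Y by exact: scalable_linear.
have fD Y Z : f (Y + Z) = f Y + f Z by have := lf 1 Y Z; rewrite !scale1r.
have f0 : f 0 = 0 by have := fZ 0 0; rewrite !scale0r.
rewrite {1}[X]matrix_sum_delta (big_morph f fD f0); apply: eq_bigr => i _.
by rewrite (big_morph f fD f0); apply: eq_bigr => j _; rewrite fZ.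
Qed.

(** Each component of f(T(x)), times the common denominator at x, is the value at x of a polynomial
    g over C(z), which has too many roots among the powers of z. *)
Lemma ratfun_dense (f : 'M[ratfun C]_(n * d) -> 'cV[ratfun C]_d) : linear f ->
  forall E : seq (ratfun C),
  (forall x, transc (cst C) x -> x \notin E -> f (mx_eval (cst C) T x) = 0) ->
  forall x, transc (cst C) x -> f (mx_eval (cst C) T x) = 0.
Proof.
move=> lf E fE; have [D [N [D0 TE]]] := common_denominator T.
pose g k := \sum_i \sum_j (f (delta_mx i j) k 0) *: map_poly (cst C) (N i j).
have gE k x : transc (cst C) x ->
    (g k).[x] = ev (cst C) x D * f (mx_eval (cst C) T x) k 0.
  move=> tx; transitivity ((ev (cst C) x D *: f (mx_eval (cst C) T x)) k 0); last by rewrite mxE.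
  rewrite -(scalable_linear lf) (mx_eval_numerator tx TE) (linear_mx_sum lf) summxE horner_sum.
  apply: eq_bigr => i _; rewrite summxE horner_sum; apply: eq_bigr => j _.
  by rewrite !mxE hornerZ mulrC -evE.
have g0 k : g k = 0.
  pose z := zvar C; have tz k' : transc (cst C) (z ^+ k'.+1).
    exact: transc_exp (@transc_zvar C).
  (* Discarding E from these distinct points leaves at least [size (g k)] roots, more than the
     degree. *)
  pose rs := [seq z ^+ i.+1 | i <- iota 0 (size E + size (g k))].
  have rs_uniq : uniq rs.
    rewrite map_inj_uniq ?iota_uniq // => i j /eqP; rewrite /z /zvar -!rmorphXn.
    rewrite tofrac_eq => /eqP /(congr1 (fun p : {poly C} => size p)).
    by rewrite !size_polyXn => -[].
  pose rs' := [seq x <- rs | x \notin E].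
  apply: contraTeq (leqnn (size (g k))) => gk0; rewrite -ltnNge.
  apply: leq_ltn_trans (max_poly_roots gk0 (rs := rs') _ _).
  - have : (size rs <= size E + size rs')%N.
      rewrite -size_cat; apply: uniq_leq_size => // x xrs.
      by rewrite mem_cat mem_filter xrs andbT orbN.
    by rewrite size_map size_iota leq_add2l.
  - apply/allP => x; rewrite mem_filter => /andP[xE /mapP[i _ xi]].
    have tx : transc (cst C) x by rewrite xi.
    by rewrite /root gE // fE // mxE mulr0.
  - exact: filter_uniq.
move=> x tx; apply/matrixP => k l; rewrite ord1 [RHS]mxE.
have /eqP := gE k x tx; rewrite g0 horner0 eq_sym mulf_eq0.
by have /negPf -> := tx D D0 => /eqP.
Qed.

End Specialization.

(** * Evaluated data and the eigenvalue formula at x = z, y = 1/z *)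

Lemma mx_eval_unit (C F : fieldType) (iota : {rmorphism C -> F}) (x : F)
    (N : nat) (T : 'M[ratfun C]_N) :
  transc iota x -> T \in unitmx -> mx_eval iota T x \in unitmx.
Proof.
move=> /rat_eval_morphism[f fE _] uT.
rewrite (_ : mx_eval iota T x = map_mx f T) ?map_unitmx //.
by apply/matrixP => i j; rewrite !mxE fE.
Qed.

(** The entries of omega are constants, so the evaluation morphism fixes it and moves only T and the
    weights. *)
Lemma highest_weight_eval (C : fieldType) (n d : nat) (T : 'M[ratfun C]_(n * d))
    (omega : 'cV[C]_d) (P : 'I_n -> ratfun C) x :
  transc (cst C) x -> highest_weight T omega P ->
  let Tx := mx_eval (cst C) T x in let w := map_mx (cst C) omega in
  (forall a b : 'I_n, (b < a)%N -> blk Tx a b *m w = 0)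
  /\ (forall a, blk Tx a a *m w = rat_eval (cst C) (P a) x *: w).
Proof.
move=> tx [_ low diag] Tx w; have [f fE fp] := rat_eval_morphism tx.
have wE : w = map_mx f w.
  apply/matrixP => i j; rewrite !mxE.
  by rewrite [cst C _]/(tofrac _) fp evE map_polyC hornerC.
have TxE a b : blk Tx a b = map_mx f (blk T a b).
  by apply/matrixP => i j; rewrite !mxE fE.
split=> [a b ltba|a]; rewrite {1}wE TxE -map_mxM; first by rewrite low ?raddf0.
by rewrite diag map_mxZ -wE fE.
Qed.

Lemma blk_KmxM (C : fieldType) (L := ratfun C) (n d m : nat) (xi z : L)
    (A B : 'M[L]_(n * d)) (w : 'cV[L]_d) (i j : 'I_n) :
  blk (A *m (Kmx n m xi z *t 1%:M) *m B) i j *m w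
  = \sum_(k < n) (if (k < m)%N then alpha xi z else beta xi z)
      *: (blk A i k *m (blk B k j *m w)).
Proof.
rewrite blkM mulmx_suml; apply: eq_bigr => k _.
rewrite blkM (bigD1 k) //= blk_scalar_tens !mxE eqxx big1 ?addr0 => [|l ne].
  by rewrite mulr1n -scalemxAr mulmx1 -!scalemxAl mulmxA.
by rewrite blk_scalar_tens !mxE (negPf ne) mulr0n scale0r mulmx0.
Qed.

Lemma fb_ratio (L : fieldType) (q z : L) k : q != 0 -> z != 0 ->
  q ^+ (2 * k) * z ^+ 4 != 1 ->
  q ^+ k * fb (z ^+ 2) / fb (q ^+ k * z ^+ 2)
  = q ^+ (2 * k) * (z ^+ 4 - 1) / (q ^+ (2 * k) * z ^+ 4 - 1).
Proof.
move=> q0 z0; rewrite -subr_eq0 mul2n -addnn exprD /fb.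
have := expf_neq0 k q0; move: (q ^+ k) => Q Q0 h.
have h' : Q * z ^+ 2 - (Q * z ^+ 2)^-1 != 0.
  apply: contraNneq h => h; apply/eqP.
  transitivity (Q * z ^+ 2 * (Q * z ^+ 2 - (Q * z ^+ 2)^-1)).
    by field; rewrite Q0 z0.
  by rewrite h mulr0.
by field; rewrite ?Q0 ?z0 ?h ?h'.
Qed.

Definition boundary_coef (L : fieldType) (q xi z : L) (m k : nat) : L :=
  if (k < m)%N then alpha xi z else q ^- (2 * m) * beta xi (z * q ^+ m).

(** q^(-2m) beta(z q^m) = q^(-2m) - xi^2 z^2: the shifted argument in Gamma is the coefficient found
    in [TinvT_weighted_sum]. *)
Lemma boundary_coefE (L : fieldType) (q xi z : L) (m k : nat) : q != 0 ->
  boundary_coef q xi z m k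
  = if (k < m)%N then alpha xi z else beta xi z - 1 + q ^- (2 * m).
Proof.
move=> q0; rewrite /boundary_coef; case: ifP => // _; rewrite /beta.
have := expf_neq0 m q0; rewrite mul2n -addnn exprD.
by move: (q ^+ m) => Q Q0; field.
Qed.

Lemma sqr_ratio_inv (L : fieldType) (z : L) : (z / z^-1) ^+ 2 = z ^+ 4.
Proof. by rewrite invrK -expr2 -exprM. Qed.

(** The difference is z^4 - 1, free of xi: this is the relation between al and be assumed in
    [TinvT_weighted_sum]. *)
Lemma alphaB_beta (L : fieldType) (xi z : L) :
  alpha xi z - beta xi z = (z / z^-1) ^+ 2 - 1.
Proof. by rewrite sqr_ratio_inv /alpha /beta; ring. Qed.

Lemma GammaE (L : fieldType) (q xi z : L) (m k : nat) : q != 0 -> z != 0 ->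
  q ^+ (2 * k) * (z / z^-1) ^+ 2 != 1 ->
  Gamma m q xi k z = gam q z z^-1 k * boundary_coef q xi z m k.
Proof.
by move=> q0 z0; rewrite /gam sqr_ratio_inv => gen; rewrite /Gamma fb_ratio.
Qed.

Theorem highest_weight_Bmx (C : fieldType) (n d m : nat) (q xi : C)
    (T : 'M[ratfun C]_(n * d)) (omega : 'cV[C]_d) (P : 'I_n -> ratfun C) :
  (m <= n)%N -> q != 0 -> q ^+ 2 != 1 ->
  monodromy q T -> highest_weight T omega P ->
  highest_weight (Bmx m q xi T) omega (Beigen m q xi P).
Proof.
move=> lemn q0 q21 [uT RTT] hw.
have cq0 : cst C q != 0 by rewrite fmorph_eq0.
have cq21 : cst C q ^+ 2 != 1 by rewrite -rmorphXn fmorph_eq1.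
have tz := @transc_zvar C; have tV := transc_inv tz; have z0 := transc_neq0 tz.
have w0 : map_mx (cst C) omega != 0.
  by rewrite map_mx_eq0; case: hw.
have tX x k : transc (cst C) x -> transc (cst C) (x * cst C q ^+ k).
  by rewrite -rmorphXn; apply: transc_mul; rewrite expf_neq0.
have tNX x k : transc (cst C) x -> transc (cst C) (x * cst C q ^- k).
  by rewrite -rmorphXn -fmorphV; apply: transc_mul; rewrite invr_eq0 expf_neq0.
have TE : T = mx_eval (cst C) T (zvar C).
  by apply/matrixP => i j; rewrite !mxE rat_eval_zvar.
(* Here u = z^2, and q^(2k) z^4 - 1 is a nonzero polynomial evaluated at z. *)
have gen k : cst C q ^+ (2 * k) * (zvar C / (zvar C)^-1) ^+ 2 != 1.
  rewrite invrK -expr2 -exprM -subr_eq0.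
  have := tz ((q ^+ (2 * k)) *: 'X^4 - 1).
  rewrite -evE rmorphB rmorph1 /= -[horner_morph _ _]/(ev _ _ _) evE.
  rewrite map_polyZ map_polyXn hornerZ hornerXn rmorphXn; apply.
  rewrite -size_poly_gt0 size_polyDl ?size_scale ?size_polyXn ?expf_neq0 //.
  by rewrite size_polyN size_poly1.
have Tunit x : transc (cst C) x -> mx_eval (cst C) T x \in unitmx.
  by move=> tx; exact: (mx_eval_unit tx uT).
have Texch x y := exchange_specialize (iota := cst C) (x := x) (y := y) RTT.
have Tdense := @ratfun_dense C n d T.
have Tlow x a b (tx : transc (cst C) x) := (highest_weight_eval tx hw).1 a b.
have Tdiag x a (tx : transc (cst C) x) := (highest_weight_eval tx hw).2 a.
have S0 x (tx : transc (cst C) x) := transc_neq0 tx.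
have low := @T_invT_low _ n d (cst C q) (transc (cst C)) (mx_eval (cst C) T)
  (map_mx (cst C) omega) cq0 S0 Tunit Texch Tdense Tlow _ _ tz tV gen.
have diag := @TinvT_weighted_sum _ n d (cst C q) (transc (cst C))
  (mx_eval (cst C) T) (map_mx (cst C) omega) (fun i x => rat_eval (cst C) (P i) x)
  cq0 cq21 S0 tX tNX Tunit Texch Tdense w0 Tlow Tdiag _ _ tz tV gen.
split; first by case: hw.
  move=> a b ltba; rewrite /Bmx {1}TE blk_KmxM big1 // => k _.
  by rewrite (low a b k ltba) scaler0.
move=> i; rewrite /Bmx {1}TE blk_KmxM.
have := diag (boundary_coef (cst C q) (cst C xi) (zvar C) m) m _ _ i lemn
  (alphaB_beta _ _) (fun k => boundary_coefE _ _ _ _ cq0).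
rewrite /TinvT => ->; congr (_ *: _).
have termE (k : 'I_n) :
    Gamma m (cst C q) (cst C xi) k (zvar C) * P k * Phat q P k (zvar C)^-1
    = gam (cst C q) (zvar C) (zvar C)^-1 k
      * boundary_coef (cst C q) (cst C xi) (zvar C) m k
      * lam (cst C q) (fun i x => rat_eval (cst C) (P i) x) (zvar C) (zvar C)^-1 k.
  (* After this [Phat] at 1/z and [invT_eigen] agree by computation. *)
  rewrite (GammaE _ _ cq0 z0 (gen k)) /lam rat_eval_zvar [RHS]mulrA.
  reflexivity.
rewrite /beig /Beigen -termE sqr_ratio_inv; congr (_ + _).
by apply: eq_bigr => k _; rewrite -termE.
Qed.

Theorem theorem2p8 (R : realType) (n d m : nat) (q xi : R[i])
    (T : 'M[ratfun R[i]]_(n * d)) (omega : 'cV[R[i]]_d)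
    (P : 'I_n -> ratfun R[i]) :
  (2 <= n)%N -> (m <= n)%N -> q != 0 -> q ^+ 2 != 1 ->
  monodromy q T ->
  highest_weight T omega P ->
  highest_weight (Bmx m q xi T) omega (Beigen m q xi P).
Proof. by move=> _; exact: highest_weight_Bmx. Qed.
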